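(* Let $\mathrm{BRO}(\mathcal{U})$ be given, satisfying (BRO-1), (BRO-2) and (BRO-3). (i) Let $\mathcal{U}$ be finite. Then the robust optimizer's approach (ROA) returns a representative set of extreme supported efficient solutions to $\mathrm{BRO}(\mathcal{U})$ in at most $|\mathcal{U}|$ iterations. (ii) Let $\mathcal{U}$ be a polytope or finite and let $f_i(x,\cdot):\mathrm{conv}(\mathcal{U})\to\mathbb{R}$, $x\in\mathcal{X}$, $i=1,2$, be continuous and quasi-convex. Then ROA returns a representative set of extreme supported efficient solutions to $\mathrm{BRO}(\mathcal{U})$ in at most $K$ iterations, where $K$ is the number of extreme points of $\mathcal{U}$, provided that an algorithm is chosen for the pessimization problem that always finds an extreme point of $\mathcal{U}$.
   Context: Orders: for $y,\bar y\in\mathbb{R}^p$, $\le$ is componentwise; $y\preceq\bar y$ ($y$ dominates $\bar y$) means $y\le\bar y$ and $y\ne\bar y$. Problem: for nonempty $\mathcal{U}'\subseteq\mathcal{U}$, $\mathrm{BRO}(\mathcal{U}')$ is the problem $\min_{x\in\mathcal{X}} f^{\mathcal{U}'}(x)$ with $f^{\mathcal{U}'}=(f_1^{\mathcal{U}'},f_2^{\mathcal{U}'})^t$, $f_i^{\mathcal{U}'}(x)=\sup_{\xi\in\mathcal{U}'}f_i(x,\xi)$, $f_1,f_2:\mathcal{X}\times\mathcal{U}\to\mathbb{R}$. (BRO-1): $\mathcal{X}=P\cap(\mathbb{Z}^k\times\mathbb{R}^{n-k})$ with $P\subseteq\mathbb{R}^n$ a polytope and $0\le k\le n$. (BRO-2):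 $\mathcal{U}\subseteq\mathbb{R}^m$ is a polytope or a finite set. (BRO-3): $f_1,f_2$ are linear in $x$ for every fixed $\xi\in\mathcal{U}$, and quasi-convex and continuous in $\xi$ for every fixed $x\in\mathcal{X}$ (for finite $\mathcal{U}$, $f_i(x,\cdot)$ is understood as a function on $\mathrm{conv}(\mathcal{U})$). The sets $\mathcal{X}$ and $\mathcal{U}$ are nonempty. Solutions: for $\min_{x\in\mathcal{X}}g(x)$ with $\mathcal{Y}=g(\mathcal{X})$, $x\in\mathcal{X}$ is efficient and $g(x)$ nondominated if no $x'\in\mathcal{X}\setminus\{x\}$ has $g(x')\preceq g(x)$. A point $y\in\mathcal{Y}$ is extreme supported nondominated if there is no convex combination of nondominated points $y^{(1)},\dots,y^{(N)}\in\mathcal{Y}\setminus\{y\}$ with $\sum_i\lambda_iy^{(i)}\le y$; $x$ is extreme supported efficient if $g(x)$ is extreme supported nondominated. A representative set of extreme supported efficient solutions is a subset of $\mathcal{X}$ whose image under $g$ is exactly the set of extreme supported nondominated points. For finite $\mathcal{U}$, ''extreme points of $\mathcal{U}$'' in (ii) means extreme points of $\mathrm{conv}(\mathcal{U})$. Dichotomic search for $\min_{x\in\mathcal{X}}(g_1(x),g_2(x))^t$: Compute $\epsilon_1=\min_{\mathcal{X}}g_1$, $x^L\in\arg\min_{x\in\mathcal{X}}\{g_2(x):g_1(x)\le\epsilon_1\}$, $y^L=g(x^L)$; $\epsilon_2=\min_{\mathcal{X}}g_2$, $x^R\in\arg\min_{x\in\mathcal{X}}\{g_1(x):g_2(x)\le\epsilon_2\}$,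 $y^R=g(x^R)$. If $y^L=y^R$, return $Y^\ast=\{y^L\}$, $X^\ast=\{x^L\}$. Otherwise set $Y^\ast=\{y^L,y^R\}$, $X^\ast=\{x^L,x^R\}$, $\mathcal{L}=\{(y^L,y^R)\}$. While $\mathcal{L}\ne\emptyset$: remove $(y^l,y^r)$ from $\mathcal{L}$; set $\lambda=(y^l_2-y^r_2,\,y^r_1-y^l_1)$; determine some $x^\ast\in\arg\min_{x\in\mathcal{X}}\lambda^Tg(x)$, $y^\ast=g(x^\ast)$; if $\lambda^Ty^\ast<\lambda^Ty^l$, add $y^\ast$ to $Y^\ast$, $x^\ast$ to $X^\ast$, and $(y^l,y^\ast),(y^\ast,y^r)$ to $\mathcal{L}$. Finally, points of $Y^\ast$ that are not extreme supported nondominated, and the corresponding solutions in $X^\ast$, are removed; return $Y^\ast,X^\ast$. ROA: Input $\mathrm{BRO}(\mathcal{U})$ and a finite nonempty initial set $\mathcal{U}^{(0)}\subseteq\mathcal{U}$. Set $j=0$. Repeat: set $\mathcal{U}^{(j+1)}=\mathcal{U}^{(j)}$; (optimization) call dichotomic search for $\mathrm{BRO}(\mathcal{U}^{(j)})$ (i.e. with $g=f^{\mathcal{U}^{(j)}}$) to determine a representative set $X^{(j)\ast}$ of extreme supported efficient solutions and the extreme supported nondominated points $Y^{(j)\ast}$; (pessimization) for every $x^\ast\in X^{(j)\ast}$ and $i=1,2$ determine one $\xi^\ast\in\arg\max_{\xi\in\mathcal{U}}f_i(x^\ast,\xi)$ and add it to $\mathcal{U}^{(j+1)}$; set $j=j+1$;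 until $f^{\mathcal{U}}(x^\ast)=f^{\mathcal{U}^{(j-1)}}(x^\ast)$ for all $x^\ast\in X^{(j-1)\ast}$. Return $X^{(j-1)\ast}$, $Y^{(j-1)\ast}$. An iteration is one pass of the repeat-loop; subproblems are assumed to be solved exactly.
   Formalization: In (ii) the bound of K iterations is proved when the initial set U^(0) contains an extreme point of U; for an arbitrary finite nonempty U^(0) the bound is K+1, because K fails in general, e.g. for U=[0,1] and U^(0)={1/2}. *)

(* Defs.v *)
(* MathComp / MathComp-Analysis *)
From HB Require Import structures.
From mathcomp Require Import all_boot all_order all_algebra.
From mathcomp Require Import all_classical all_reals all_analysis.

Set Implicit Arguments.
Unset Strict Implicit.
Unset Printing Implicit Defensive.

Import Order.TTheory GRing.Theory Num.Theory.
Import numFieldNormedType.Exports.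

Local Open Scope classical_set_scope.
Local Open Scope ring_scope.

Section Convexity.
Variables (R : realType) (E : lmodType R).

(* All finite convex combinations; [N = 0] is excluded by the weights summing
   to 1. *)
Definition conv_hull (A : set E) : set E :=
  [set x | exists (N : nat) (a : 'I_N -> E) (l : 'I_N -> R),
    [/\ forall i, A (a i), forall i, 0 <= l i, \sum_i l i = 1
      & x = \sum_i l i *: a i]].

Definition polytope (C : set E) : Prop :=
  exists2 V : set E, finite_set V & C = conv_hull V.

Definition extreme_points (C : set E) : set E :=
  [set x | C x /\ forall (y z : E) (t : R), C y -> C z -> 0 < t < 1 ->
    x = t *: y + (1 - t) *: z -> y = z].

Definition quasi_convex_on (C : set E) (h : E -> R) : Prop :=
  forall (x y : E) (t : R), C x -> C y -> 0 <= t <= 1 ->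
    h (t *: x + (1 - t) *: y) <= Num.max (h x) (h y).

End Convexity.

Section MultiobjectiveOptimization.
Variable R : realType.

Definition argmin (T : Type) (X : set T) (h : T -> R) : set T :=
  [set x | X x /\ forall x', X x' -> h x <= h x'].

Definition argmax (T : Type) (X : set T) (h : T -> R) : set T :=
  [set x | X x /\ forall x', X x' -> h x' <= h x].

Definition le_vec (p : nat) (y z : 'rV[R]_p) : Prop :=
  forall i, y 0 i <= z 0 i.

Definition dominates (p : nat) (y z : 'rV[R]_p) : Prop :=
  le_vec y z /\ y <> z.

Section Solutions.
Variables (T : Type) (p : nat) (X : set T) (g : T -> 'rV[R]_p).

Definition efficient : set T :=
  [set x | X x /\ ~ exists x', [/\ X x', x' <> x & dominates (g x') (g x)]].

Definition nondominated : set 'rV[R]_p := g @` efficient.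

Definition ext_supp_nondominated : set 'rV[R]_p :=
  [set y | (g @` X) y /\
    ~ exists2 z, conv_hull (nondominated `\ y) z & le_vec z y].

Definition ext_supp_efficient : set T :=
  [set x | X x /\ ext_supp_nondominated (g x)].

Definition representative_ese (S : set T) : Prop :=
  S `<=` X /\ g @` S = ext_supp_nondominated.

End Solutions.

Section DichotomicSearch.
Variables (T : Type) (X : set T) (g : T -> 'rV[R]_2).

(* The two objectives are the coordinates [0] and [1] of ['rV[R]_2]. *)
Definition lex_argmin (i j : 'I_2) : set T :=
  [set x | exists2 e, ((fun x' => g x' 0 i) @` argmin X (fun x' => g x' 0 i)) e
    & argmin (X `&` [set x' | g x' 0 i <= e]) (fun x' => g x' 0 j) x].

Definition scalarize (yl yr y : 'rV[R]_2) : R :=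
  (yl 0 1 - yr 0 1) * y 0 0 + (yr 0 0 - yl 0 0) * y 0 1.

Inductive ds_state :=
| DsStart
| DsLoop of set 'rV[R]_2 & set T & set ('rV[R]_2 * 'rV[R]_2)
| DsDone of set 'rV[R]_2 & set T.

(* Every choice left open by the algorithm (the optimal solution found by a
   subproblem, the pair taken from the list) is a nondeterministic branch. *)
Inductive ds_step : ds_state -> ds_state -> Prop :=
| DsSingle xL xR :
    lex_argmin 0 1 xL -> lex_argmin 1 0 xR -> g xL = g xR ->
    ds_step DsStart (DsDone [set g xL] [set xL])
| DsInit xL xR :
    lex_argmin 0 1 xL -> lex_argmin 1 0 xR -> g xL <> g xR ->
    ds_step DsStart
      (DsLoop [set g xL; g xR] [set xL; xR] [set (g xL, g xR)])
| DsSplit Ys Xs L yl yr x :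
    L (yl, yr) -> argmin X (fun x' => scalarize yl yr (g x')) x ->
    scalarize yl yr (g x) < scalarize yl yr yl ->
    ds_step (DsLoop Ys Xs L)
      (DsLoop (Ys `|` [set g x]) (Xs `|` [set x])
         ((L `\ (yl, yr)) `|` [set (yl, g x); (g x, yr)]))
| DsDiscard Ys Xs L yl yr x :
    L (yl, yr) -> argmin X (fun x' => scalarize yl yr (g x')) x ->
    ~ scalarize yl yr (g x) < scalarize yl yr yl ->
    ds_step (DsLoop Ys Xs L) (DsLoop Ys Xs (L `\ (yl, yr)))
| DsFilter Ys Xs :
    ds_step (DsLoop Ys Xs set0)
      (DsDone (Ys `&` ext_supp_nondominated X g)
         (Xs `&` [set x | ext_supp_nondominated X g (g x)])).

End DichotomicSearch.
End MultiobjectiveOptimization.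

Section RobustOptimization.
Variables (R : realType) (n m : nat).
Implicit Types (X : set 'rV[R]_n) (U : set 'rV[R]_m).
Implicit Types (f : 'I_2 -> 'rV[R]_n -> 'rV[R]_m -> R).

Definition worst_case f U (x : 'rV[R]_n) : 'rV[R]_2 :=
  \row_i sup [set f i x xi | xi in U].

Definition bro1 (k : nat) X : Prop :=
  exists2 P : set 'rV[R]_n, polytope P &
    X = P `&` [set x | forall i : 'I_n, (i < k)%N -> x 0 i \is a Num.int].

Definition bro2 U : Prop := polytope U \/ finite_set U.

(* The objectives are total functions; nothing is assumed about their values
   outside of X and conv(U). If U is a polytope then conv(U) = U. *)
Definition bro3 X U f : Prop :=
  (forall i xi, U xi -> exists phi : {linear 'rV[R]_n -> R^o},
     forall x, X x -> f i x xi = phi x) /\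
  (forall i x, X x -> quasi_convex_on (conv_hull U) (f i x) /\
     {within conv_hull U, continuous (f i x)}).

Section Roa.
Variables (X : set 'rV[R]_n) (U : set 'rV[R]_m).
Variable f : 'I_2 -> 'rV[R]_n -> 'rV[R]_m -> R.
(* The pessimization algorithm returns only scenarios in [D]. *)
Variable D : set 'rV[R]_m.

Definition pessimization (Xs : set 'rV[R]_n) (U0 U1 : set 'rV[R]_m) : Prop :=
  exists2 w : 'rV[R]_n -> 'I_2 -> 'rV[R]_m,
    (forall x i, Xs x -> argmax U (f i x) (w x i) /\ D (w x i)) &
    U1 = U0 `|` [set xi | exists x i, Xs x /\ xi = w x i].

(* [RoaPass j Uj s]: j passes of the repeat-loop are completed, and the
   dichotomic search for the scenario set Uj is in state s.
   [RoaReturned j Xs Ys]: Xs and Ys were returned after j passes in total. *)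
Inductive roa_state :=
| RoaPass of nat & set 'rV[R]_m & ds_state R 'rV[R]_n
| RoaReturned of nat & set 'rV[R]_n & set 'rV[R]_2.

Inductive roa_step : roa_state -> roa_state -> Prop :=
| RoaSearch j Uj s s' :
    ds_step X (worst_case f Uj) s s' ->
    roa_step (RoaPass j Uj s) (RoaPass j Uj s')
| RoaContinue j Uj Uj' Ys Xs :
    pessimization Xs Uj Uj' ->
    ~ (forall x, Xs x -> worst_case f U x = worst_case f Uj x) ->
    roa_step (RoaPass j Uj (DsDone Ys Xs)) (RoaPass j.+1 Uj' (DsStart _ _))
| RoaStop j Uj Uj' Ys Xs :
    pessimization Xs Uj Uj' ->
    (forall x, Xs x -> worst_case f U x = worst_case f Uj x) ->
    roa_step (RoaPass j Uj (DsDone Ys Xs)) (RoaReturned j.+1 Xs Ys).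

Definition returned_within (N : nat) (s : roa_state) : Prop :=
  if s is RoaReturned j Xs _
  then (j <= N)%N /\ representative_ese X (worst_case f U) Xs
  else False.

End Roa.
End RobustOptimization.

(* Total correctness of a nondeterministic transition system: every maximal
   execution from [s] reaches [Q]; none gets stuck or runs forever before. *)
Inductive inevitably (S : Type) (step : S -> S -> Prop) (Q : S -> Prop)
    (s : S) : Prop :=
| inevitably_now : Q s -> inevitably step Q s
| inevitably_next : (exists s', step s s') ->
    (forall s', step s s' -> inevitably step Q s') -> inevitably step Q s.

(* Every execution that starts with the scenario set U0, and whose
   pessimization steps find scenarios in [D], returns a representative set of
   extreme supported efficient solutions after at most [N] passes. *)
Definition roa_correct_within (R : realType) (n m : nat)
    (X : set 'rV[R]_n) (U : set 'rV[R]_m)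
    (f : 'I_2 -> 'rV[R]_n -> 'rV[R]_m -> R) (D U0 : set 'rV[R]_m) (N : nat) :=
  inevitably (roa_step X U f D) (returned_within X U f N)
    (RoaPass 0 U0 (DsStart R 'rV[R]_n)).

(* Main.v *)
(* Write g for the worst-case objective of a finite scenario set.  Fixing the
   integer coordinates, X is a finite union of polytopes on which g is a
   maximum of finitely many linear functions, so by Minkowski's theorem for
   truncated epigraphs finitely many image points generate the image up to
   convex combination and domination.  A minimal such generating set is exactly
   the set of extreme supported nondominated points.

   In the dichotomic search a split of (yl, yr) at g x encloses strictly fewer
   extreme supported points in each of the new pairs, because the optimal face
   through g x has extreme points weakly on both sides of g x.  Hence the
   search terminates.  Discarding a pair is harmless, since then every image
   point between yl and yr lies on or above the segment joining them.

   A pass of the outer loop that does not stop adds a new scenario from D, the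
   scenarios which pessimization may return.  When it stops, the relaxation g
   is exact at a representative set for g, which makes that set representative
   for the full problem.  In (ii), quasi-convexity provides a maximizing
   scenario among the finitely many extreme points. *)
Require Import Defs.
From HB Require Import structures.
From mathcomp Require Import all_boot all_order all_algebra finmap.
From mathcomp Require Import all_classical all_reals all_analysis.
From mathcomp Require Import ring lra zify.

Set Implicit Arguments.
Unset Strict Implicit.
Unset Printing Implicit Defensive.

Import Order.TTheory GRing.Theory Num.Theory.
Import numFieldNormedType.Exports.

Local Open Scope classical_set_scope.
Local Open Scope ring_scope.

(** * Convex hulls and extreme points *)

Section FiniteSets.

Lemma finite_argmin (R : realType) (T : choiceType) (A : set T) (h : T -> R) :
  finite_set A -> A !=set0 -> argmin A h !=set0.
Proof.
move=> /finite_seqP[s ->]; elim: s => [|x s IHs] [y].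
  by rewrite /= in_nil.
move=> _; have [s0|/set0P/IHs[z [zs zmin]]] := eqVneq [set` s] set0.
  exists x; split=> [|x' /=]; first by rewrite /= mem_head.
  rewrite inE => /predU1P[->//|x's].
  by have : [set` s] x' by []; rewrite s0.
case: (leP (h x) (h z)) => [xz|/ltW zx].
  exists x; split=> [|x' /=]; first by rewrite /= mem_head.
  by rewrite inE => /predU1P[->//|/zmin]; exact: le_trans.
exists z; split=> [|x' /=]; first by rewrite /= inE (zs : z \in s) orbT.
by rewrite inE => /predU1P[->//|/zmin].
Qed.

Lemma finite_argmax (R : realType) (T : choiceType) (A : set T) (h : T -> R) :
  finite_set A -> A !=set0 -> argmax A h !=set0.
Proof.
move=> fA A0; have [x [Ax xmin]] := finite_argmin (fun x => - h x) fA A0.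
by exists x; split=> // x' /xmin; rewrite lerN2.
Qed.

Lemma ltn_card_fset_set (T : choiceType) (A B : set T) (x : T) :
  finite_set B -> A `<=` B -> B x -> ~ A x ->
  (#|` fset_set A| < #|` fset_set B|)%N.
Proof.
move=> fB AB Bx nAx; have fA : finite_set A by exact: sub_finite_set fB.
apply: fproper_ltn_card; rewrite fproperE; apply/andP; split.
  by rewrite -fset_set_sub.
apply/fsubsetPn; exists x; first by rewrite in_fset_set ?inE.
by rewrite in_fset_set// notin_setE.
Qed.

Lemma finite_minimal_subset (T : choiceType) (P : set T -> Prop) (A : set T) :
  finite_set A -> P A ->
  exists S, [/\ S `<=` A, P S & forall s, S s -> ~ P (S `\ s)].
Proof.
move=> fA; have [n] := ubnP #|` fset_set A|.
elim: n A fA => // n IHn A fA ltAn PA.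
have [[s [As Ps]]|minA] := pselect (exists s, A s /\ P (A `\ s)); last first.
  by exists A; split=> // s As Ps; apply: minA; exists s.
have fAs : finite_set (A `\ s) by exact: finite_setD.
have [|S [SA PS minS]] := IHn _ fAs _ Ps.
  apply: leq_trans (ltAn : (_ <= n)%N).
  by apply: (@ltn_card_fset_set _ _ _ s) => // -[_ /(_ erefl)].
by exists S; split=> //; apply: subset_trans SA _; exact: subDsetl.
Qed.

End FiniteSets.

Section ConvexHulls.
Variables (R : realType) (E : lmodType R).
Implicit Types (A B C S : set E) (x y z s : E).

Definition convex_closed C := forall x y (t : R),
  C x -> C y -> 0 <= t <= 1 -> C (t *: x + (1 - t) *: y).

Lemma conv_hull_sub A : A `<=` conv_hull A.
Proof.
move=> x Ax; exists 1%N, (fun=> x), (fun=> 1); split=> //; rewrite ?big_ord1//.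
by rewrite scale1r.
Qed.

Lemma conv_hull_closed A : convex_closed (conv_hull A).
Proof.
move=> _ _ t [N1 [a1 [l1 [Aa1 l10 l11 ->]]]] [N2 [a2 [l2 [Aa2 l20 l21 ->]]]].
case/andP=> t0 t1.
pose a i := match @fintype.split N1 N2 i with inl j => a1 j | inr j => a2 j end.
pose l i := match @fintype.split N1 N2 i with
  inl j => t * l1 j | inr j => (1 - t) * l2 j end.
exists (N1 + N2)%N, a, l; split.
- by move=> i; rewrite /a; case: fintype.split.
- move=> i; rewrite /l.
  by case: fintype.split => j; rewrite mulr_ge0// subr_ge0.
- rewrite big_split_ord/= /l.
  under eq_bigr do rewrite (unsplitK (inl _)).
  under [X in _ + X]eq_bigr do rewrite (unsplitK (inr _)).
  by rewrite -!mulr_sumr l11 l21; ring.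
- rewrite big_split_ord/= /l /a !scaler_sumr; congr (_ + _).
    by apply: eq_bigr => i _; rewrite (unsplitK (inl _)) scalerA.
  by apply: eq_bigr => i _; rewrite (unsplitK (inr _)) scalerA.
Qed.

(** Induction on the number of points: the first is split off and the other weights are rescaled by
    [1 - l ord0], unless this is zero. *)
Lemma conv_hull_min A C : convex_closed C -> A `<=` C -> conv_hull A `<=` C.
Proof.
move=> cC AC _ [N [a [l [Aa l0 l1 ->]]]].
elim: N a l Aa l0 l1 => [|N IHN] a l Aa l0 l1.
  by move: l1; rewrite big_ord0 => /esym/eqP; rewrite oner_eq0.
rewrite big_ord_recl; move: l1; rewrite big_ord_recl => l1.
have suml : \sum_(i < N) l (lift ord0 i) = 1 - l ord0 by rewrite -l1; ring.
have [l0E|l0N1] := eqVneq (l ord0) 1.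
  rewrite l0E scale1r big1 ?addr0; first exact/AC.
  move=> i _; have /psumr_eq0P : \sum_(i < N) l (lift ord0 i) = 0.
    by rewrite suml l0E subrr.
  by move=> ->//; rewrite scale0r.
have lt01 : 0 < 1 - l ord0.
  by rewrite lt_neqAle eq_sym subr_eq0 eq_sym l0N1 -suml sumr_ge0.
rewrite (_ : \sum_(i < N) _ = (1 - l ord0) *:
   \sum_(i < N) (l (lift ord0 i) / (1 - l ord0)) *: a (lift ord0 i)).
  apply: cC; first exact/AC; last by rewrite l0/= -subr_ge0 ltW.
  apply: IHN => // [i|]; first by rewrite divr_ge0// ltW.
  by rewrite -mulr_suml suml divff// gt_eqF.
rewrite scaler_sumr; apply: eq_bigr => i _; rewrite scalerA mulrC divfK//.
by rewrite gt_eqF.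
Qed.

Lemma conv_hull_nonempty A : conv_hull A !=set0 -> A !=set0.
Proof.
case=> x hx; apply/set0P/eqP => A0.
by have : (set0 : set E) x by apply: conv_hull_min hx; rewrite ?A0// => ?.
Qed.

Lemma sub_conv_hull A B : A `<=` B -> conv_hull A `<=` conv_hull B.
Proof.
move=> AB; apply: conv_hull_min; first exact: conv_hull_closed.
exact: subset_trans (@conv_hull_sub B).
Qed.

Lemma conv_hullK A : conv_hull (conv_hull A) = conv_hull A.
Proof.
apply/seteqP; split; last exact: conv_hull_sub.
by apply: conv_hull_min => //; exact: conv_hull_closed.
Qed.

(** Half-open segments from [conv_hull A] towards [s]. As the weight of [s] stays below 1, [s]
    itself belongs only if [conv_hull A] contains it. *)
Definition cone_over s A : set E := [set v | exists a w,
  [/\ 0 <= a < 1, conv_hull A w & v = a *: s + (1 - a) *: w]].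

Lemma cone_over_mix s A v w (t : R) : 0 < t <= 1 ->
  cone_over s A v -> (w = s \/ cone_over s A w) ->
  cone_over s A (t *: v + (1 - t) *: w).
Proof.
case/andP=> t0 t1 [a [v' [/andP[a0 a1] Av' ->]]] [->|].
  exists (t * a + (1 - t)), v'; split=> //.
    by apply/andP; split; nra.
  rewrite scalerDr !scalerA addrAC -scalerDl; congr (_ *: _ + _ *: _); ring.
case=> [b [w' [/andP[b0 b1] Aw' ->]]].
set c := t * a + (1 - t) * b.
have c0 : 0 <= c by rewrite /c; nra.
have c1 : 0 < 1 - c.
  have -> : 1 - c = t * (1 - a) + (1 - t) * (1 - b) by rewrite /c; ring.
  rewrite ltr_pwDl ?mulr_gt0 ?subr_gt0// mulr_ge0// subr_ge0//; exact: ltW.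
(* [c] is the total weight of [s]; the remainder [1 - c] normalizes the weights of [v'] and [w']. *)
exists c, ((t * (1 - a) / (1 - c)) *: v' + (1 - t * (1 - a) / (1 - c)) *: w').
split; first by rewrite c0 -subr_gt0.
  apply: conv_hull_closed => //; apply/andP; split.
    by rewrite divr_ge0 ?mulr_ge0 ?subr_ge0// ltW// -subr_gt0.
  by rewrite ler_pdivrMr// mul1r /c; nra.
rewrite !scalerDr !scalerA addrACA -scalerDl -/c; congr (_ + _).
by congr (_ *: _ + _ *: _); rewrite /c; field; apply: lt0r_neq0.
Qed.

Lemma cone_over_closed s A : convex_closed (cone_over s A).
Proof.
move=> v w t Cv Cw /andP[t0 t1]; have [t_eq0|tN0] := eqVneq t 0.
  by rewrite t_eq0 scale0r subr0 scale1r add0r.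
by apply: cone_over_mix => //; [rewrite lt_neqAle eq_sym tN0 t0|right].
Qed.

Lemma conv_hull_split S s w :
  conv_hull S w -> w = s \/ cone_over s (S `\ s) w.
Proof.
apply: (@conv_hull_min _ [set w | w = s \/ cone_over s (S `\ s) w]) w
  => [v1 v2 t|v Sv]; last first.
  have [->|vs] := eqVneq v s; [by left|right].
  exists 0, v; split; rewrite ?lexx ?ltr01//; last first.
    by rewrite scale0r subr0 scale1r add0r.
  by apply: conv_hull_sub; split=> //; exact/eqP.
move=> v1E v2E /andP[t0 t1].
have [->|tN0] := eqVneq t 0; first by rewrite scale0r subr0 scale1r add0r.
have [->|tN1] := eqVneq t 1; first by rewrite subrr scale1r scale0r addr0.
have t0' : 0 < t by rewrite lt_neqAle eq_sym tN0.
have t1' : t < 1 by rewrite lt_neqAle tN1.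
case: v1E => [->|Cv1]; last by right; apply: cone_over_mix; rewrite ?t0'.
case: v2E => [->|Cv2]; first by left; rewrite -scalerDl addrC subrK scale1r.
right; rewrite addrC [in t *: s](_ : t = 1 - (1 - t)); last by ring.
by apply: cone_over_mix; [rewrite subr_gt0 t1' lerBlDr lerDl|  |left].
Qed.

Lemma cone_over_self s A : cone_over s A s -> conv_hull A s.
Proof.
case=> [a [w [/andP[a0 a1] Aw sE]]]; suff -> : s = w by [].
apply: (@scalerI _ _ (1 - a)); first by rewrite gt_eqF// subr_gt0.
by rewrite scalerBl scale1r {1}sE addrC addKr.
Qed.

(** By extremality, removing [x] from the hull leaves a convex set. If [x] were not in [S], this set
    would contain [S] and hence the whole hull. *)
Lemma extreme_sub_generators S x : extreme_points (conv_hull S) x -> S x.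
Proof.
case=> Sx ex; apply: contrapT => nSx.
have [C [cC SC nCx]] : exists C : set E, [/\ convex_closed C, S `<=` C & ~ C x].
  exists (conv_hull S `\ x); split.
  - move=> y z t [Sy yx] [Sz zx] /andP[t0 t1].
    have [->|tN0] := eqVneq t 0; first by rewrite scale0r subr0 scale1r add0r.
    have [->|tN1] := eqVneq t 1; first by rewrite subrr scale1r scale0r addr0.
    split; first by apply: conv_hull_closed => //; rewrite t0.
    move=> xE; have yz : y = z.
      apply: (ex _ _ t) => //.
      by rewrite !lt_neqAle eq_sym tN0 t0 tN1.
    by apply: yx; rewrite -xE -yz -scalerDl addrC subrK scale1r.
  - move=> y Sy; split; first exact: conv_hull_sub.
    by move=> yx; apply: nSx; rewrite -yx.
  - by case=> _ /(_ erefl).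
by apply: nCx; exact: conv_hull_min SC _ Sx.
Qed.

(** In a minimal generating set every [s] is extreme: if [s] is a proper mixture of hull points not
    both equal to [s], it lies in the cone over itself, so the other generators already produce
    it. *)
Lemma extreme_points_generate (V : set E) : finite_set V ->
  [/\ extreme_points (conv_hull V) `<=` V,
      finite_set (extreme_points (conv_hull V))
    & conv_hull (extreme_points (conv_hull V)) = conv_hull V].
Proof.
move=> fV; have EV := @extreme_sub_generators V.
split=> //; first exact: sub_finite_set fV.
have [S [SV SE minS]] :=
  @finite_minimal_subset _ (fun S => conv_hull S = conv_hull V) V fV erefl.
apply/seteqP; split; first exact: sub_conv_hull.
rewrite -[X in X `<=` _]SE; apply: sub_conv_hull => s Ss.
have nSs : ~ conv_hull (S `\ s) s.
  move=> hs; apply: (minS s) => //; rewrite -SE; apply/seteqP; split.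
    by apply: sub_conv_hull; exact: subDsetl.
  apply: conv_hull_min => [|v Sv]; first exact: conv_hull_closed.
  have [->//|vs] := eqVneq v s.
  by apply: conv_hull_sub; split=> //; exact/eqP.
rewrite -SE; split; first exact: conv_hull_sub.
move=> y z t /(conv_hull_split s) yE /(conv_hull_split s) zE /andP[t0 t1] sE.
have cone_abs v w r : 0 < r < 1 -> s = r *: v + (1 - r) *: w ->
    cone_over s (S `\ s) v -> w = s \/ cone_over s (S `\ s) w -> False.
  move=> /andP[r0 r1] {}sE Cv Cw; apply/nSs/cone_over_self.
  rewrite [X in _ X]sE.
  by apply: cone_over_mix => //; rewrite r0 ltW.
case: yE => [yE|Cy]; last first.
  by exfalso; apply: (cone_abs y z t) => //; rewrite t0.
case: zE => [zE|Cz]; first by rewrite yE zE.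
exfalso; apply: (cone_abs z y (1 - t)) => //; last by left.
  by rewrite subr_gt0 t1 ltrBlDr ltrDl.
by rewrite opprB addrC [1 + _]addrC subrK.
Qed.

Lemma argmax_extreme_points (V : set E) (h : E -> R) :
  finite_set V -> V !=set0 -> quasi_convex_on (conv_hull V) h ->
  exists e, extreme_points (conv_hull V) e /\ argmax (conv_hull V) h e.
Proof.
move=> fV [v Vv] qh.
have [EV fE EE] := extreme_points_generate fV.
have E0 : extreme_points (conv_hull V) !=set0.
  by apply: conv_hull_nonempty; rewrite EE; exists v; exact: conv_hull_sub.
have [e [Ee emax]] := finite_argmax h fE E0.
exists e; split=> //; split; first by case: Ee.
(* The set on the right is convex by quasi-convexity, so it contains the hull of the extreme points.
   Membership in the hull is carried along because quasi-convexity is assumed only there. *)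
suff sub : conv_hull V `<=` [set x | conv_hull V x /\ h x <= h e].
  by move=> x /sub[].
rewrite -[X in X `<=` _]EE.
apply: conv_hull_min => [x y t [Vx hx] [Vy hy] t01|x Ex].
  split; first exact: conv_hull_closed.
  by rewrite (le_trans (qh _ _ _ Vx Vy t01))// ge_max hx.
by split; [case: Ex|exact: emax].
Qed.

End ConvexHulls.

(** * Minkowski's theorem *)

Section Polyhedra.
Variables (R : realType) (E : lmodType R).
Implicit Types (Q : set E) (p q d : E).

Lemma scalar_at0 (h : E -> R) : scalar h -> h 0 = 0.
Proof.
move=> lh; apply: (addrI (h 0)); rewrite addr0 -{1}[h 0]mul1r.
by have /= <- := lh 1 0 0; rewrite scaler0 addr0.
Qed.

Lemma scalar_comb (h : E -> R) (s t : R) p q :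
  scalar h -> h (s *: p + t *: q) = s * h p + t * h q.
Proof.
move=> lh; rewrite lh; congr (_ + _).
by have /= := lh t q 0; rewrite scalar_at0// !addr0.
Qed.

Definition polyhedron Q := exists (J : finType) (a : J -> E -> R) (b : J -> R),
  (forall j, scalar (a j)) /\ Q = [set p | forall j, a j p <= b j].

Lemma polyhedron_halfspace (h : E -> R) (c : R) :
  scalar h -> polyhedron [set p | h p <= c].
Proof.
move=> lh; exists unit, (fun=> h), (fun=> c); split=> //.
by apply/seteqP; split=> p /=; [move=> ? []|exact].
Qed.

Lemma polyhedron_bigcap (I : finType) (Q : I -> set E) :
  (forall i, polyhedron (Q i)) -> polyhedron [set p | forall i, Q i p].
Proof.
move=> /(_ _)/cid-/all_sig[J] /(_ _)/cid-/all_sig[a] /(_ _)/cid-/all_sig[b] ab.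
exists {i : I & J i}, (fun k => a (tag k) (tagged k)),
  (fun k => b (tag k) (tagged k)).
split=> [[i j]|]; first by case: (ab i).
apply/seteqP; split=> p /= Qp.
  by move=> [i j]; have := Qp i; case: (ab i) => _ -> /=.
by move=> i; case: (ab i) => _ -> /= j; exact: (Qp (Tagged J j)).
Qed.

Lemma polyhedronI Q1 Q2 : polyhedron Q1 -> polyhedron Q2 ->
  polyhedron (Q1 `&` Q2).
Proof.
move=> P1 P2; rewrite (_ : _ `&` _ = [set p | forall b : bool,
  (if b then Q1 else Q2) p]); first by apply: polyhedron_bigcap => -[].
apply/seteqP; split=> p; first by move=> [? ?] [].
by move=> Qp; split; [exact: (Qp true)|exact: (Qp false)].
Qed.

Lemma polyhedron_hyperplane (h : E -> R) (c : R) :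
  scalar h -> polyhedron [set p | h p = c].
Proof.
move=> lh; rewrite (_ : [set p | _] =
    [set p | h p <= c] `&` [set p | - h p <= - c]).
  apply: polyhedronI; apply: polyhedron_halfspace => // s u v.
  by rewrite lh; ring.
apply/seteqP; split=> p /=; first by move=> ->.
by rewrite lerN2 => -[? ?]; apply/eqP; rewrite eq_le; apply/andP.
Qed.

Section Minkowski.
Variables (J : finType) (a : J -> E -> R) (b : J -> R).
Hypothesis lin_a : forall j, scalar (a j).
Let Q : set E := [set p | forall j, a j p <= b j].
(** Boundedness in algebraic form: [Q] contains no half-line. *)
Hypothesis no_ray : forall p d, Q p -> d != 0 ->
  exists2 t : R, 0 <= t & ~ Q (p + t *: d).

Let act p : {set J} := [set j | a j p == b j]%SET.

Let aD j p q : a j (p + q) = a j p + a j q.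
Proof. by have := scalar_comb 1 1 p q (lin_a j); rewrite !scale1r !mul1r. Qed.

Let aZ j t p : a j (t *: p) = t * a j p.
Proof. by rewrite -[_ *: _]addr0 lin_a scalar_at0 ?addr0. Qed.

(** Moving along [d] keeps the active constraints tight. As the half-line leaves [Q], some [a j]
    increases along it; the smallest ratio of slack to increase is the step at which a further
    constraint becomes tight. *)
Let new_active_constraint p d : Q p -> d != 0 ->
    (forall j, j \in act p -> a j d = 0) ->
  exists t : R, [/\ 0 < t, Q (p + t *: d)
    & (#|~: act (p + t *: d)| < #|~: act p|)%N].
Proof.
move=> Qp dN0 actd.
have [j0 j0_gt0] : exists j, 0 < a j d.
  apply: contrapT => nj; have [t t0] := no_ray Qp dN0; apply => j.
  rewrite aD aZ (le_trans _ (Qp j))// gerDl mulr_ge0_le0// leNgt.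
  by apply/negP => aj0; apply: nj; exists j.
have act0 j : 0 < a j d -> j \notin act p.
  by move=> ajd; apply: contraL ajd => /actd ->; rewrite ltxx.
have slack j : j \notin act p -> 0 < b j - a j p.
  by rewrite inE => nj; rewrite subr_gt0 lt_neqAle nj; exact: Qp.
case: (@arg_minP _ R J j0 (fun j => 0 < a j d) (fun j => (b j - a j p) / a j d)
  j0_gt0) => j j_gt0 jmin.
exists ((b j - a j p) / a j d); set t := _ / _.
have t0 : 0 < t by rewrite divr_gt0// slack// act0.
have Qt : Q (p + t *: d).
  move=> i; rewrite aD aZ; case: (ltP 0 (a i d)) => [id0|id0].
    by rewrite -lerBrDl -ler_pdivlMr// jmin.
  by rewrite (le_trans _ (Qp i))// gerDl mulr_ge0_le0// ltW.
split=> //; apply: proper_card; rewrite finset.properC.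
apply/fintype.properP; split.
  apply/fintype.subsetP => i ip; have := ip; rewrite !inE => /eqP ipE.
  by rewrite aD aZ (actd _ ip) mulr0 addr0 ipE.
exists j; last exact: act0.
rewrite inE; apply/eqP; rewrite aD aZ /t divfK; last by rewrite gt_eqF.
by rewrite addrC subrK.
Qed.

(** Vertices are the points determined by their active constraints, so [act] is injective on them
    and they are finitely many. *)
Let vertices : set E :=
  [set p | Q p /\ forall q, Q q -> act p \subset act q -> q = p].

Let finite_vertices : finite_set vertices.
Proof.
pose v A := xget 0 [set p | vertices p /\ act p = A].
apply: (@sub_finite_set _ _ (v @` setT)); last exact/finite_image/finite_finset.
move=> p vp; exists (act p) => //.
have [[_ vmax] vE] : ([set q | vertices q /\ act q = act p]) (v (act p)).
  by apply: xgetPex; exists p.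
by apply/esym/vmax; [case: vp | rewrite vE].
Qed.

(** Induction on the number of inactive constraints. If [p] is no vertex, another point [q] keeps
    all its active constraints; moving from [p] along [q - p] and backwards reaches two points with
    fewer inactive constraints, and [p] lies between them. *)
Let sub_conv_vertices : Q `<=` conv_hull vertices.
Proof.
move=> p; have [n] := ubnP #|~: act p|; elim: n p => // n IHn p ltpn Qp.
have [vp|nvp] := pselect (vertices p); first exact: conv_hull_sub.
have [q [Qq pq qNp]] : exists q, [/\ Q q, act p \subset act q & q <> p].
  apply: contrapT => nq; apply: nvp; split=> // q Qq pq; apply: contrapT => qp.
  by apply: nq; exists q.
have act_dir j : j \in act p -> a j (q - p) = 0.
  move=> jp; have /(_ j jp) := fintype.subsetP pq _.
  move: jp; rewrite !inE => /eqP jp /eqP jq.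
  by rewrite -scaleN1r addrC lin_a jp jq mulN1r addrC subrr.
have dN0 : q - p != 0 by rewrite subr_eq0; exact/eqP.
have [|t [t0 Qt ltt]] := new_active_constraint Qp dN0; first exact: act_dir.
have [|j jp|s [s0 Qs lts]] := @new_active_constraint p (- (q - p)) Qp.
- by rewrite oppr_eq0.
- by rewrite -scaleN1r aZ act_dir ?mulr0.
have -> : p = (s / (t + s)) *: (p + t *: (q - p)) +
              (1 - s / (t + s)) *: (p + s *: - (q - p)).
  move: (q - p) => d.
  rewrite !scalerDr addrACA -scalerDl subrKC scale1r !scalerN !scalerA.
  rewrite (_ : _ * s = s / (t + s) * t) ?subrr ?addr0//.
  by field; rewrite gt_eqF ?addr_gt0.
apply: conv_hull_closed.
- exact/IHn/Qt/(leq_trans ltt).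
- exact/IHn/Qs/(leq_trans lts).
- rewrite ltW ?divr_gt0 ?addr_gt0//= ler_pdivrMr ?addr_gt0// mul1r.
  by rewrite lerDr ltW.
Qed.

Lemma Minkowski_halfspaces : polytope Q.
Proof.
exists vertices => //; apply/seteqP; split=> //; apply: conv_hull_min.
  move=> p q t Qp Qq /andP[t0 t1] j; rewrite aD !aZ.
  by have := Qp j; have := Qq j; nra.
by move=> p [].
Qed.

End Minkowski.

Lemma Minkowski Q : polyhedron Q ->
    (forall p d, Q p -> d != 0 -> exists2 t : R, 0 <= t & ~ Q (p + t *: d)) ->
  polytope Q.
Proof. by move=> [J [a [b [lin_a ->]]]]; exact: Minkowski_halfspaces. Qed.

End Polyhedra.

(** * Extreme supported nondominated points *)

Section ComponentwiseOrder.
Variables (R : realType) (p : nat).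
Implicit Types (y z w : 'rV[R]_p) (C S : set 'rV[R]_p).

Lemma le_vec_refl y : le_vec y y. Proof. by move=> i. Qed.

Lemma le_vec_trans y z w : le_vec y z -> le_vec z w -> le_vec y w.
Proof. by move=> yz zw i; exact: le_trans (yz i) (zw i). Qed.

Lemma le_vec_anti y z : le_vec y z -> le_vec z y -> y = z.
Proof. by move=> yz zy; apply/rowP => i; apply/eqP; rewrite eq_le yz zy. Qed.

Definition upper_set C : set 'rV[R]_p := [set y | exists2 z, C z & le_vec z y].

Lemma upper_set_closed C : convex_closed C -> convex_closed (upper_set C).
Proof.
move=> cC y1 y2 t [z1 Cz1 zy1] [z2 Cz2 zy2] /andP[t0 t1].
exists (t *: z1 + (1 - t) *: z2); first by apply: cC; rewrite ?t0.
by move=> i; rewrite !mxE lerD// ler_wpM2l// subr_ge0.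
Qed.

Lemma sub_upper_set C : C `<=` upper_set C.
Proof. by move=> y Cy; exists y => //; exact: le_vec_refl. Qed.

Lemma conv_hull_sub_upper_set C S :
  S `<=` upper_set (conv_hull C) ->
  upper_set (conv_hull S) `<=` upper_set (conv_hull C).
Proof.
move=> SC y [z Sz zy].
have [w Cw wz] : upper_set (conv_hull C) z.
  by apply: conv_hull_min SC _ Sz; apply/upper_set_closed/conv_hull_closed.
by exists w => //; exact: le_vec_trans zy.
Qed.

(** Since [a < 1], the part [a *: y] cancels and leaves [w] below [y]. *)
Lemma cone_over_upper_self S y :
  upper_set (cone_over y S) y -> upper_set (conv_hull S) y.
Proof.
case=> _ [a [w [/andP[a0 a1] Sw ->]]] le_y; exists w => // i.
by move: (le_y i); rewrite !mxE; nra.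
Qed.

End ComponentwiseOrder.

Section SupportedPoints.
Variables (R : realType) (T : Type) (p : nat) (X : set T) (g : T -> 'rV[R]_p).
Implicit Types (S : set 'rV[R]_p) (y z w : 'rV[R]_p).

Lemma nondominated_min y x :
  nondominated X g y -> X x -> le_vec (g x) y -> g x = y.
Proof.
case=> x0 [Xx0 eff] <- Xx le_x; apply: contrapT => ne; apply: eff.
by exists x; split=> // xx0; apply: ne; rewrite xx0.
Qed.

(** Different images force different solutions, so nondominance can be read off the image alone. *)
Lemma nondominatedP y : nondominated X g y <->
  (g @` X) y /\ forall x, X x -> le_vec (g x) y -> g x = y.
Proof.
split=> [ndy|[[x Xx <-] xmin]].
  split; last by move=> x; exact: nondominated_min.
  by case: ndy => x [Xx _] <-; exists x.
exists x => //; split=> // -[x' [Xx' _ [le_x']]]; apply; exact: xmin.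
Qed.

(** A hull point of [S] below a nondominated [y'] other than [y] cannot be [y], so it lies in the
    cone over [y]. The combination below [y] is therefore above a cone point, and cancelling [y]
    leaves a combination of the other points of [S]. *)
Lemma non_extreme_redundant S y :
  g @` X `<=` upper_set (conv_hull S) -> (g @` X) y ->
  upper_set (conv_hull (nondominated X g `\ y)) y ->
  upper_set (conv_hull (S `\ y)) y.
Proof.
move=> XS [x0 Xx0 x0y] [z ndz zy]; apply: cone_over_upper_self.
suff [v Cv vz] : upper_set (cone_over y (S `\ y)) z.
  by exists v => //; exact: le_vec_trans zy.
apply: conv_hull_min ndz; first exact/upper_set_closed/cone_over_closed.
move=> y' [ndy' y'y]; have [x Xx xy'] : (g @` X) y' by case/nondominatedP: ndy'.
have [w Sw wy'] := XS _ (ex_intro2 _ _ x Xx xy').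
case: (conv_hull_split y Sw) => [wy|Cw]; last by exists w.
case: y'y; rewrite /= -x0y; apply/esym/(nondominated_min ndy' Xx0).
by rewrite x0y -wy.
Qed.

(** Otherwise the hull point of [S] below [y] would combine nondominated points other than [y]. *)
Lemma extreme_mem_dominating S y :
  g @` X `<=` upper_set (conv_hull S) -> S `<=` nondominated X g ->
  ext_supp_nondominated X g y -> S y.
Proof.
move=> XS Snd [Xy ext]; apply: contrapT => nSy; apply: ext.
have [z Sz zy] := XS _ Xy; exists z => //; apply: sub_conv_hull Sz => s Ss.
by split; [exact: Snd|move=> sy; apply: nSy; rewrite -sy].
Qed.

Lemma ext_supp_generate S0 :
  finite_set S0 -> S0 `<=` g @` X -> g @` X `<=` upper_set (conv_hull S0) ->
  [/\ finite_set (ext_supp_nondominated X g),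
      ext_supp_nondominated X g `<=` nondominated X g
    & g @` X `<=` upper_set (conv_hull (ext_supp_nondominated X g))].
Proof.
move=> fS0 S0X XS0.
have [S [SS0 XS minS]] := @finite_minimal_subset _
  (fun S => g @` X `<=` upper_set (conv_hull S)) S0 fS0 XS0.
have irred s : S s -> ~ upper_set (conv_hull (S `\ s)) s.
  move=> Ss sS; apply: (minS _ Ss); apply: subset_trans XS _.
  apply: conv_hull_sub_upper_set => s' Ss'; have [->//|s's] := eqVneq s' s.
  by apply/sub_upper_set/conv_hull_sub; split=> //; exact/eqP.
have SX s : S s -> (g @` X) s by move=> /SS0/S0X.
(* If [g x] is below [s], some hull point [w] is below [g x]. Either [w] is [s], so [g x = s], or
   [w] is in the cone over [s] and makes [s] redundant. *)
have Snd : S `<=` nondominated X g.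
  move=> s Ss; apply/nondominatedP; split=> [|x Xx xs]; first exact: SX.
  have [w Sw wx] := XS _ (ex_intro2 _ _ x Xx erefl).
  case: (conv_hull_split s Sw) => [ws|Cw].
    by apply: le_vec_anti => //; rewrite -ws.
  exfalso; apply: (irred _ Ss); apply: cone_over_upper_self.
  by exists w => //; exact: le_vec_trans xs.
have -> : ext_supp_nondominated X g = S.
  apply/seteqP; split=> s; first exact: extreme_mem_dominating.
  move=> Ss; split; first exact: SX.
  by move=> /(non_extreme_redundant XS (SX _ Ss)); exact: irred.
by split=> //; exact: sub_finite_set fS0.
Qed.

End SupportedPoints.

(** [g] is a relaxation of [G] that is exact on [Xs]. So [S] is attained by [G] and still dominates
    its larger values; a value [G x] below [s] in [S] forces [g x = s], whence [s] is below [G x]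
    too. *)
Lemma representative_ese_relax (R : realType) (T : Type) (p : nat) (X : set T)
    (g G : T -> 'rV[R]_p) (Xs : set T) :
  (forall x, X x -> le_vec (g x) (G x)) ->
  (forall x, Xs x -> G x = g x) ->
  ext_supp_nondominated X g `<=` nondominated X g ->
  g @` X `<=` upper_set (conv_hull (ext_supp_nondominated X g)) ->
  representative_ese X g Xs -> representative_ese X G Xs.
Proof.
set S := ext_supp_nondominated X g => gG eqXs Snd XS [XsX gXs].
have GXs : G @` Xs = S.
  rewrite /S -gXs; apply/seteqP.
  by split=> _ [x Xsx <-]; exists x => //; rewrite eqXs.
have GXS : G @` X `<=` upper_set (conv_hull S).
  move=> _ [x Xx <-]; have [z Sz zx] := XS _ (ex_intro2 _ _ x Xx erefl).
  by exists z => //; apply: le_vec_trans zx _; exact: gG.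
have SG : S `<=` G @` X.
  by rewrite -GXs => _ [x Xsx <-]; exists x => //; exact: XsX.
have SndG : S `<=` nondominated X G.
  move=> s Ss; apply/nondominatedP; split=> [|x Xx xs]; first exact: SG.
  apply: le_vec_anti => //.
  rewrite -(nondominated_min (Snd _ Ss) Xx (le_vec_trans (gG _ Xx) xs)).
  exact: gG.
split=> //; rewrite GXs; apply/seteqP; split=> s.
  move=> Ss; split; first exact: SG.
  move=> /(non_extreme_redundant GXS (SG _ Ss)) [z Sz zs].
  case: (Ss) => _; apply; exists z => //; apply: sub_conv_hull Sz.
  by move=> s' [/Snd].
exact: extreme_mem_dominating.
Qed.

(** * Dichotomic search *)

Lemma conv_hull_scalar_ge (R : realType) (E : lmodType R) (A : set E)
    (h : E -> R) (c : R) (w : E) :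
  scalar h -> (forall z, A z -> c <= h z) -> conv_hull A w -> c <= h w.
Proof.
move=> lh Ac; move: w.
apply: (@conv_hull_min _ _ _ [set v | c <= h v]) => //.
move=> u v t /= cu cv /andP[t0 t1].
by rewrite scalar_comb//; nra.
Qed.

(** The points lexicographically above [y] with respect to [a], then [b], form a convex set. If no
    such [z] existed, it would contain [A], hence [y] itself. *)
Lemma conv_hull_lex_min (R : realType) (E : lmodType R) (A : set E)
    (a b : E -> R) (y : E) :
  scalar a -> scalar b -> conv_hull A y -> (forall z, A z -> a y <= a z) ->
  exists z, [/\ A z, a z = a y & b z <= b y].
Proof.
move=> la lb Ay amin; apply: contrapT => nz.
suff /(_ y Ay) : conv_hull A `<=`
    [set v | a y < a v \/ a v = a y /\ b y < b v].
  by rewrite /= !ltxx => -[|[]].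
apply: conv_hull_min => [u v t Cu Cv /andP[t0 t1]|z Az] /=; last first.
  case: (ltgtP (a y) (a z)) (amin _ Az) => // [|ayz _]; [by left|right].
  by split=> //; rewrite ltNge; apply/negP => bz; apply: nz; exists z.
have [->|tN0] := eqVneq t 0; first by rewrite scale0r subr0 scale1r add0r.
have [->|tN1] := eqVneq t 1; first by rewrite subrr scale1r scale0r addr0.
have t0' : 0 < t by rewrite lt_neqAle eq_sym tN0.
have t1' : 0 < 1 - t by rewrite subr_gt0 lt_neqAle tN1.
rewrite !scalar_comb//; case: Cu => [au|[au bu]]; case: Cv => [av|[av bv]].
- by left; nra.
- by left; nra.
- by left; nra.
- by right; split; [rewrite au av; ring|nra].
Qed.

Section Plane.
Variable R : realType.
Implicit Types y z : 'rV[R]_2.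

Lemma ord2_ind (P : 'I_2 -> Prop) : P 0 -> P 1 -> forall i, P i.
Proof.
by move=> P0 P1 [[|[|//]] lti];
  [rewrite (_ : Ordinal _ = 0)|rewrite (_ : Ordinal _ = 1)] => //;
  exact/val_inj.
Qed.

Lemma le_vec2P y z : le_vec y z <-> y 0 0 <= z 0 0 /\ y 0 1 <= z 0 1.
Proof. by split=> [yz|[yz0 yz1]]; [split; exact: yz|exact: ord2_ind]. Qed.

Lemma scalar_scalarize (yl yr : 'rV[R]_2) : scalar (scalarize yl yr).
Proof. by move=> t y z; rewrite /scalarize !mxE; ring. Qed.

Lemma scalar_coord n (i : 'I_n) : scalar (fun y : 'rV[R]_n => y 0 i).
Proof. by move=> t y z; rewrite !mxE. Qed.

Lemma scalar_opp_coord n (i : 'I_n) : scalar (fun y : 'rV[R]_n => - y 0 i).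
Proof. by move=> t y z; rewrite !mxE; ring. Qed.

End Plane.

Section DichotomicSearchCorrect.
Variables (R : realType) (T : Type) (X : set T) (g : T -> 'rV[R]_2).
Let S := ext_supp_nondominated X g.
Hypotheses (X0 : X !=set0) (fS : finite_set S).
Hypothesis XS : g @` X `<=` upper_set (conv_hull S).

Let below x : X x -> upper_set (conv_hull S) (g x).
Proof. by move=> Xx; apply: XS; exists x. Qed.

Let attained s : S s -> exists2 x, X x & g x = s.
Proof. by case. Qed.

Let S0 : S !=set0.
Proof.
case: X0 => x /below[z Sz _]; apply: conv_hull_nonempty; by exists z.
Qed.

Let weighted_min (a b : R) (s : 'rV[R]_2) : 0 <= a -> 0 <= b ->
    argmin S (fun y => a * y 0 0 + b * y 0 1) s ->
  forall x, X x -> a * s 0 0 + b * s 0 1 <= a * g x 0 0 + b * g x 0 1.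
Proof.
move=> a0 b0 [Ss smin] x /below[w Sw /le_vec2P[w0 w1]].
apply: (@le_trans _ _ (a * w 0 0 + b * w 0 1)); last first.
  by rewrite lerD// ler_wpM2l.
by apply: conv_hull_scalar_ge smin Sw => t y z; rewrite !mxE; ring.
Qed.

Lemma argmin_weighted (a b : R) : 0 <= a -> 0 <= b ->
  argmin X (fun x => a * g x 0 0 + b * g x 0 1) !=set0.
Proof.
move=> a0 b0.
have [s smin] :=
  finite_argmin (fun y : 'rV[R]_2 => a * y 0 0 + b * y 0 1) fS S0.
have [x Xx xs] := attained smin.1.
by exists x; split=> // x' Xx'; rewrite xs; exact: weighted_min.
Qed.

Lemma lex_argmin_nonempty i j : lex_argmin X g i j !=set0.
Proof.
have [s [Ss smin]] := finite_argmin (fun y : 'rV[R]_2 => y 0 i) fS S0.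
have [x0 Xx0 x0s] := attained Ss.
have convmin w : conv_hull S w -> s 0 i <= w 0 i.
  exact: conv_hull_scalar_ge (scalar_coord i) smin.
have fSe : finite_set (S `&` [set y | y 0 i = s 0 i]) by exact: finite_setIl.
have Se0 : S `&` [set y | y 0 i = s 0 i] !=set0 by exists s.
have [s1 [[Ss1 s1i] s1min]] :=
  finite_argmin (fun y : 'rV[R]_2 => y 0 j) fSe Se0.
have [x1 Xx1 x1s] := attained Ss1.
exists x1; exists (s 0 i).
  exists x0; last by rewrite x0s.
  split=> // x' /below[w /convmin sw wx]; rewrite x0s.
  exact: le_trans sw (wx i).
split; first by split=> //; rewrite /= x1s s1i.
move=> x' [/below[w Sw wx] /= x's]; rewrite x1s.
have wi : w 0 i = s 0 i.
  by apply/eqP; rewrite eq_le convmin// andbT (le_trans (wx i)).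
(* [w] lies on the face of the hull where coordinate [i] is minimal; some point of [S] on this face
   is at most [w] in coordinate [j]. *)
have [|z [Sz zi zj]] := conv_hull_lex_min (@scalar_coord R 2 i)
    (@scalar_coord R 2 j) Sw.
  by move=> z Sz; rewrite wi; exact: smin.
by rewrite (le_trans (s1min z _))//;
  [split=> //=; rewrite zi|exact: le_trans (wx j)].
Qed.

Lemma lex_argminP i j x : lex_argmin X g i j x ->
  [/\ X x, forall x', X x' -> g x 0 i <= g x' 0 i
    & forall x', X x' -> g x' 0 i <= g x 0 i -> g x 0 j <= g x' 0 j].
Proof.
case=> _ [x0 [Xx0 x0min] <-] [[Xx /= xe] xmin]; split=> // x' Xx'.
  exact: le_trans xe (x0min _ Xx').
by move=> x'x; apply: xmin; split=> //=; exact: le_trans xe.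
Qed.

Let supporting (y : 'rV[R]_2) := exists a b : R, [/\ 0 <= a, 0 <= b, 0 < a + b &
  forall x, X x -> a * y 0 0 + b * y 0 1 <= a * g x 0 0 + b * g x 0 1].

(** What holds for every point the search finds. Such a point may lie inside an edge and fail to be
    extreme, hence the final filter. *)
Let good (y : 'rV[R]_2) := nondominated X g y /\ supporting y.

Let lex_argmin01_good x : lex_argmin X g 0 1 x -> good (g x).
Proof.
move=> /lex_argminP[Xx xmin0 xmin1]; split.
  apply/nondominatedP; split=> [|x' Xx' le_x']; first by exists x.
  apply: le_vec_anti => //; apply/le_vec2P; split; first exact: xmin0.
  by apply: xmin1 => //; exact: le_x'.
exists 1, 0; split=> // x' Xx'.
by rewrite !mul1r !mul0r !addr0; exact: xmin0.
Qed.

Let lex_argmin10_good x : lex_argmin X g 1 0 x -> good (g x).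
Proof.
move=> /lex_argminP[Xx xmin0 xmin1]; split.
  apply/nondominatedP; split=> [|x' Xx' le_x']; first by exists x.
  apply: le_vec_anti => //; apply/le_vec2P; split; last exact: xmin0.
  by apply: xmin1 => //; exact: le_x'.
exists 0, 1; split=> // x' Xx'.
by rewrite !mul1r !mul0r !add0r; exact: xmin0.
Qed.

(** A point below the line through [yl] and [yr] but not to the right of [yl] would be cut off by
    the supporting line at [yl], since [yr] is not; if that line is vertical, the point dominates
    [yl] instead. The argument at [yr] is symmetric. *)
Let between (yl yr : 'rV[R]_2) x : good yl -> good yr ->
    yl 0 0 < yr 0 0 -> yr 0 1 < yl 0 1 ->
    X x -> scalarize yl yr (g x) < scalarize yl yr yl ->
  [/\ yl 0 0 < g x 0 0, g x 0 0 < yr 0 0, yr 0 1 < g x 0 1 & g x 0 1 < yl 0 1].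
Proof.
move=> [ndl [a [b [a0 b0 ab supl]]]] [ndr [c [d [c0 d0 cd supr]]]] lr0 lr1 Xx.
have ndl_x := nondominated_min ndl Xx; have ndr_x := nondominated_min ndr Xx.
have [xl Xxl xlE] : (g @` X) yl by case/nondominatedP: ndl.
have [xr Xxr xrE] : (g @` X) yr by case/nondominatedP: ndr.
move: (supl _ Xx) (supl _ Xxr) (supr _ Xx) (supr _ Xxl); rewrite xlE xrE.
rewrite /scalarize => {supl supr xlE xrE}.
set u0 := g x 0 0; set u1 := g x 0 1 => supx supxr supx' supxl lt_x.
have l0 : yl 0 0 < u0.
  rewrite ltNge; apply/negP => u0l.
  have [bE|bN0] := eqVneq b 0.
    have a_gt0 : 0 < a by rewrite bE addr0 in ab.
    have u0E : u0 = yl 0 0.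
      apply/eqP; rewrite eq_le u0l/=.
      by move: supx; rewrite bE !mul0r !addr0 ler_pM2l.
    have u1l : u1 < yl 0 1 by nra.
    suff : u1 = yl 0 1 by move=> E; move: u1l; rewrite E ltxx.
    by rewrite /u1 ndl_x//; apply/le_vec2P; split=> //; exact: ltW.
  have b_gt0 : 0 < b by rewrite lt_neqAle eq_sym bN0.
  (* The expression in [h3] equals the one in [h1] minus the one in [h2], so it cannot be
     negative. *)
  have h1 : 0 <=
      (yr 0 0 - yl 0 0) * (a * (u0 - yl 0 0) + b * (u1 - yl 0 1)) by nra.
  have h2 : (a * (yr 0 0 - yl 0 0) + b * (yr 0 1 - yl 0 1)) *
      (u0 - yl 0 0) <= 0 by nra.
  have h3 : b * ((yl 0 1 - yr 0 1) * (u0 - yl 0 0) +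
      (yr 0 0 - yl 0 0) * (u1 - yl 0 1)) < 0 by nra.
  nra.
have r1 : yr 0 1 < u1.
  rewrite ltNge; apply/negP => u1r.
  have [cE|cN0] := eqVneq c 0.
    have d_gt0 : 0 < d by rewrite cE add0r in cd.
    have u1E : u1 = yr 0 1.
      apply/eqP; rewrite eq_le u1r/=.
      by move: supx'; rewrite cE !mul0r !add0r ler_pM2l.
    have u0r : u0 < yr 0 0 by nra.
    suff : u0 = yr 0 0 by move=> E; move: u0r; rewrite E ltxx.
    by rewrite /u0 ndr_x//; apply/le_vec2P; split=> //; exact: ltW.
  have c_gt0 : 0 < c by rewrite lt_neqAle eq_sym cN0.
  have h1 : 0 <=
      (yl 0 1 - yr 0 1) * (c * (u0 - yr 0 0) + d * (u1 - yr 0 1)) by nra.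
  have h2 : (c * (yl 0 0 - yr 0 0) + d * (yl 0 1 - yr 0 1)) *
      (u1 - yr 0 1) <= 0 by nra.
  have h3 : c * ((yl 0 1 - yr 0 1) * (u0 - yr 0 0) +
      (yr 0 0 - yl 0 0) * (u1 - yr 0 1)) < 0 by nra.
  nra.
by split=> //; nra.
Qed.

Let argmin_scalarize (yl yr : 'rV[R]_2) :
    yl 0 0 < yr 0 0 -> yr 0 1 < yl 0 1 ->
  argmin X (fun x => scalarize yl yr (g x)) !=set0.
Proof. by move=> lr0 lr1; apply: argmin_weighted; rewrite subr_ge0 ltW. Qed.

(* Even if the optimal point g x found by the search lies in the relative
   interior of an edge, extreme points of that edge lie weakly on both sides. *)
Let extreme_optimum (yl yr : 'rV[R]_2) x (h : 'rV[R]_2 -> R) :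
    yl 0 0 < yr 0 0 -> yr 0 1 < yl 0 1 ->
    argmin X (fun x => scalarize yl yr (g x)) x -> scalar h ->
  exists z, [/\ S z, scalarize yl yr z = scalarize yl yr (g x)
    & h z <= h (g x)].
Proof.
move=> lr0 lr1 [Xx xmin] lh; have [w Sw wx] := below Xx.
have wlx : scalarize yl yr w <= scalarize yl yr (g x).
  by rewrite lerD// ler_wpM2l// subr_ge0 ltW.
have Smin z : S z -> scalarize yl yr (g x) <= scalarize yl yr z.
  by case/attained => x' Xx' <-; exact: xmin.
have xlw : scalarize yl yr (g x) <= scalarize yl yr w.
  exact: conv_hull_scalar_ge (scalar_scalarize yl yr) Smin Sw.
have wE : w = g x.
  apply: le_vec_anti => //; apply/le_vec2P.
  move/le_vec2P: wx => [w0 w1]; move: xlw; rewrite /scalarize => ?.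
  by split; nra.
have [|z [Sz zw hz]] := conv_hull_lex_min (scalar_scalarize yl yr) lh Sw.
  by move=> z /Smin; exact: le_trans.
by exists z; split=> //; rewrite -wE.
Qed.

Let strip (q : 'rV[R]_2 * 'rV[R]_2) :=
  S `&` [set y | q.1 0 0 < y 0 0 < q.2 0 0].

(** A split creates two pairs, each enclosing fewer points of [S]. With base 3 each has at most a
    third of the old rank, so the total drops. *)
Let rank q := (3 ^ #|` fset_set (strip q)|)%N.

Let finite_strip q : finite_set (strip q). Proof. exact: finite_setIl. Qed.

Let rank_lt q q' z : strip q `<=` strip q' -> strip q' z -> ~ strip q z ->
  (3 * rank q <= rank q')%N.
Proof.
by move=> qq' q'z qz; rewrite -expnS leq_exp2l// (ltn_card_fset_set _ qq' q'z).
Qed.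

Let rank_split (yl yr : 'rV[R]_2) x : good yl -> good yr ->
    yl 0 0 < yr 0 0 -> yr 0 1 < yl 0 1 ->
    argmin X (fun x => scalarize yl yr (g x)) x ->
    scalarize yl yr (g x) < scalarize yl yr yl ->
  (rank (yl, g x) + rank (g x, yr) < rank (yl, yr))%N.
Proof.
move=> gl gr lr0 lr1 xmin ltx; have [Xx _] := xmin.
have [lx xr _ _] := between gl gr lr0 lr1 Xx ltx.
have inner z : S z -> scalarize yl yr z = scalarize yl yr (g x) ->
    strip (yl, yr) z.
  move=> Sz zx; split=> //=; have [x' Xx' x'z] := attained Sz.
  have [|lz zr _ _] := between gl gr lr0 lr1 Xx'; first by rewrite x'z zx.
  by rewrite -x'z lz.
(* [z1] is weakly right of [g x] and so lost to the left pair; [z2] is weakly left of it and lost to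
   the right pair. *)
have [z1 [Sz1 z1x /= z1r]] :=
  extreme_optimum lr0 lr1 xmin (scalar_opp_coord 0).
have [z2 [Sz2 z2x /= z2l]] := extreme_optimum lr0 lr1 xmin (scalar_coord 0).
have rank1 : (3 * rank (yl, g x) <= rank (yl, yr))%N.
  apply: (@rank_lt _ _ z1); last 2 first.
  - exact: inner.
  - by case=> _ /= /andP[_]; rewrite ltNge -lerN2 z1r.
  - by move=> y [Sy /andP[/= ly yx]]; split=> //=; rewrite ly (lt_trans yx).
have rank2 : (3 * rank (g x, yr) <= rank (yl, yr))%N.
  apply: (@rank_lt _ _ z2); last 2 first.
  - exact: inner.
  - by case=> _ /= /andP[]; rewrite ltNge z2l.
  - by move=> y [Sy /andP[/= xy yr0]]; split=> //=; rewrite (lt_trans lx).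
have : (0 < rank (yl, yr))%N by rewrite expn_gt0.
lia.
Qed.

(** The last clause localizes the unfinished work: once no pair is left, the hull of [Ys] dominates
    the whole image. *)
Let invariant (Ys : set 'rV[R]_2) (Xs : set T)
    (L : set ('rV[R]_2 * 'rV[R]_2)) :=
  [/\ finite_set Xs /\ Xs `<=` X, Ys = g @` Xs, (forall y, Ys y -> good y),
    (forall q, L q ->
       [/\ Ys q.1, Ys q.2, q.1 0 0 < q.2 0 0 & q.2 0 1 < q.1 0 1])
  & forall x, X x -> upper_set (conv_hull Ys) (g x) \/
      exists2 q, L q & q.1 0 0 <= g x 0 0 <= q.2 0 0].

Definition ds_correct (s : ds_state R T) : Prop :=
  if s is DsDone Ys Xs then finite_set Xs /\ representative_ese X g Xs
  else False.

Let invariant_discard Ys Xs L (yl yr : 'rV[R]_2) x :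
    invariant Ys Xs L -> L (yl, yr) ->
    argmin X (fun x => scalarize yl yr (g x)) x ->
    ~ scalarize yl yr (g x) < scalarize yl yr yl ->
  invariant Ys Xs (L `\ (yl, yr)).
Proof.
move=> [fXs YsE gYs Lp cover] Lq [Xx xmin] /negP; rewrite -leNgt => ltx.
have [/= Ysl Ysr lr0 lr1] := Lp _ Lq.
split=> // [q [/Lp//]|x' Xx'].
case: (cover _ Xx') => [|[q Lq' qx]]; [by left|].
have [qE|qN] := eqVneq q (yl, yr); last first.
  by right; exists q => //; split=> //; exact/eqP.
left; move: qx; rewrite qE /= => /andP[lx xr].
have {}xmin : scalarize yl yr yl <= scalarize yl yr (g x').
  by rewrite (le_trans ltx)// xmin.
pose d := yr 0 0 - yl 0 0.
have d0 : 0 < d by rewrite subr_gt0.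
(* With this weight the point on the segment from [yl] to [yr] has the first coordinate of [g x'];
   as no point is below the line, [g x'] is on or above it. *)
pose t := (yr 0 0 - g x' 0 0) / d.
have t0 : 0 <= t by rewrite divr_ge0 ?subr_ge0// ltW.
have t1 : t <= 1 by rewrite ler_pdivrMr// mul1r lerB.
have tE : t * d = yr 0 0 - g x' 0 0 by rewrite divfK// gt_eqF.
exists (t *: yl + (1 - t) *: yr).
  by apply: conv_hull_closed; rewrite ?t0//; exact: conv_hull_sub.
apply/le_vec2P; rewrite !mxE; split.
  by rewrite /d in tE; nra.
rewrite -(ler_pM2l d0); move: xmin; rewrite /scalarize -/d => xmin.
have -> : d * (t * yl 0 1 + (1 - t) * yr 0 1) =
    (t * d) * (yl 0 1 - yr 0 1) + d * yr 0 1 by ring.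
by rewrite tE; move: xmin; rewrite /d; nra.
Qed.

Let invariant_split Ys Xs L (yl yr : 'rV[R]_2) x :
    invariant Ys Xs L -> L (yl, yr) ->
    argmin X (fun x => scalarize yl yr (g x)) x ->
    scalarize yl yr (g x) < scalarize yl yr yl ->
  invariant (Ys `|` [set g x]) (Xs `|` [set x])
    ((L `\ (yl, yr)) `|` [set (yl, g x); (g x, yr)]).
Proof.
move=> [[fXs XsX] YsE gYs Lp cover] Lq [Xx xmin] ltx.
have [/= Ysl Ysr lr0 lr1] := Lp _ Lq.
have [lx xr rx xl] := between (gYs _ Ysl) (gYs _ Ysr) lr0 lr1 Xx ltx.
have pos1 : 0 < yl 0 1 - yr 0 1 by rewrite subr_gt0.
have pos0 : 0 < yr 0 0 - yl 0 0 by rewrite subr_gt0.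
split.
- split; first by rewrite finite_setU.
  by move=> x' [/XsX//|->].
- by rewrite image_setU image_set1 YsE.
- move=> y [/gYs//|->]; split.
    apply/nondominatedP; split=> [|x' Xx' le_x']; first by exists x.
    apply: le_vec_anti => //; apply/le_vec2P.
    move/le_vec2P: le_x' => [le0 le1]; move: (xmin _ Xx'); rewrite /scalarize.
    by move=> ?; split; nra.
  exists (yl 0 1 - yr 0 1), (yr 0 0 - yl 0 0); split; rewrite ?ltW// addr_gt0//.
- move=> q [[/Lp[q1 q2 ? ?] _]|[->|->]] /=; first by split=> //; left.
    by split=> //; [left|right].
  by split=> //; [right|left].
- move=> x' Xx'; case: (cover _ Xx') => [[z Yz zx']|[q Lq' qx]].
    by left; exists z => //; apply: sub_conv_hull Yz => ? ?; left.
  right; have [qE|qN] := eqVneq q (yl, yr); last first.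
    by exists q => //; left; split=> //; exact/eqP.
  move: qx; rewrite qE /= => /andP[lx' x'r].
  case: (leP (g x' 0 0) (g x 0 0)) => [x'x|/ltW xx'].
    by exists (yl, g x); [right; left|rewrite /= lx'].
  by exists (g x, yr); [right; right|rewrite /= xx'].
Qed.

Let invariant_filter Ys Xs : invariant Ys Xs set0 ->
  ds_correct (DsDone (Ys `&` S) (Xs `&` [set x | S (g x)])).
Proof.
move=> [[fXs XsX] YsE gYs _ cover]; split; first exact: finite_setIl.
split; first by move=> x [/XsX].
apply/seteqP; split=> [_ [x [_ Sx] <-]//|y Sy].
suff : Ys y.
  by rewrite YsE => -[x Xsx xy]; exists x => //; split=> //=; rewrite xy.
apply: extreme_mem_dominating Sy => [_ [x Xx <-]|z /gYs[]//].
by case: (cover _ Xx) => // -[].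
Qed.

(** Induction on the sum of the ranks of the open pairs: a discard removes a positive rank, and
    [rank_split] covers a split. *)
Lemma ds_loop_correct Ys Xs L : finite_set L -> invariant Ys Xs L ->
  inevitably (ds_step X g) ds_correct (DsLoop Ys Xs L).
Proof.
move=> /finite_seqP[s LE]; have [n] := ubnP (\sum_(q <- s) rank q)%N.
elim: n Ys Xs L s LE => // n IHn Ys Xs L s LE lt_n inv.
have [_ _ gYs Lp _] := inv.
apply: inevitably_next => [|s' st].
  have [L0|/set0P[[yl yr] Lq]] := eqVneq L set0.
    by rewrite L0; eexists; exact: DsFilter.
  have [_ _ lr0 lr1] := Lp _ Lq; have [x xmin] := argmin_scalarize lr0 lr1.
  have [ltx|geq] := pselect (scalarize yl yr (g x) < scalarize yl yr yl).
    by eexists; exact: DsSplit xmin ltx.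
  by eexists; exact: DsDiscard xmin geq.
(* The list may repeat pairs. All copies of [q] are removed, so the sum drops by at least
   [rank q]. *)
have drop q : L q -> L `\ q = [set` [seq q' <- s | q' != q]] /\
    (\sum_(q' <- [seq q' <- s | q' != q]) rank q' + rank q <=
     \sum_(q' <- s) rank q')%N.
  move=> Lq; split.
    rewrite LE; apply/seteqP; split=> q' /=; rewrite mem_filter.
      by move=> [-> /eqP ->].
    by move=> /andP[/eqP ? ?].
  rewrite big_filter [leqRHS](bigID (fun q' => q' != q))/= leq_add2l.
  have sq : q \in s by move: Lq; rewrite LE.
  rewrite (big_rem q)//=; under eq_bigl do rewrite negbK.
  by rewrite negbK eqxx leq_addr.
move E: (DsLoop Ys Xs L) st => s0 st; case: st E => //.
- move=> Ys0 Xs0 L0 yl yr x Lq xmin ltx [? ? ?]; subst Ys0 Xs0 L0.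
  have [E le_s] := drop _ Lq; have [/= Ysl Ysr lr0 lr1] := Lp _ Lq.
  apply: (IHn _ _ _ ((yl, g x) :: (g x, yr) :: [seq q' <- s | q' != (yl, yr)])).
  - rewrite E; apply/seteqP; split=> q /=; rewrite !inE.
      by move=> [->|[->|->]]; rewrite ?eqxx ?orbT.
    by move=> /or3P[/eqP->|/eqP->|]; [right; left|right; right|left].
  - rewrite !big_cons addnA.
    by have := rank_split (gYs _ Ysl) (gYs _ Ysr) lr0 lr1 xmin ltx; lia.
  - exact: invariant_split.
- move=> Ys0 Xs0 L0 yl yr x Lq xmin geq [? ? ?]; subst Ys0 Xs0 L0.
  have [E le_s] := drop _ Lq.
  apply: (IHn _ _ _ _ E); last exact: invariant_discard xmin geq.
  have : (0 < rank (yl, yr))%N by rewrite expn_gt0.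
  by lia.
- move=> _ _ [<- <- L0]; apply: inevitably_now; apply: invariant_filter.
  by rewrite L0 in inv.
Qed.

Lemma dichotomic_search_correct :
  inevitably (ds_step X g) ds_correct (DsStart R T).
Proof.
have [xL lexL] := lex_argmin_nonempty 0 1.
have [xR lexR] := lex_argmin_nonempty 1 0.
apply: inevitably_next => [|s' st].
  have [eqLR|neLR] := pselect (g xL = g xR).
    by eexists; exact: DsSingle lexL lexR eqLR.
  by eexists; exact: DsInit lexL lexR neLR.
move=> {xL xR lexL lexR}; move E: (DsStart R T) st => s0 st; case: st E => //.
- move=> xL xR lexL lexR eqLR _; apply: inevitably_now.
  have [XxL minL _] := lex_argminP lexL; have [XxR minR _] := lex_argminP lexR.
  split; first exact: finite_set1.
  (* The common point is below the whole image, so the invariant holds with no open pair. *)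
  have inv : invariant [set g xL] [set xL] set0.
    split=> //; first by split=> [|_ ->]; [exact: finite_set1|].
    - by rewrite image_set1.
    - by move=> _ ->; exact: lex_argmin01_good.
    - move=> x Xx; left; exists (g xL); first exact: conv_hull_sub.
      by apply/le_vec2P; rewrite minL// eqLR minR.
  have SY : S `<=` [set g xL].
    move=> s; apply: extreme_mem_dominating => [_ [x Xx <-]|z zE].
      by case: inv => _ _ _ _ /(_ x Xx)[|[]].
    by case: inv => _ _ /(_ z zE)[].
  split=> [_ ->//|]; rewrite image_set1; apply/seteqP; split=> [_ ->|//].
  by have [s Ss] := S0; have /= <- := SY _ Ss.
- move=> xL xR lexL lexR neLR _.
  apply: ds_loop_correct; first exact: finite_set1.
  have [XxL minL lexL'] := lex_argminP lexL.
  have [XxR minR lexR'] := lex_argminP lexR.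
  have lt0 : g xL 0 0 < g xR 0 0.
    rewrite lt_neqAle minL// andbT; apply/eqP => eq0; apply: neLR.
    apply: le_vec_anti; apply/le_vec2P; last by rewrite eq0 minR.
    by rewrite eq0 lexL' ?eq0.
  have lt1 : g xR 0 1 < g xL 0 1.
    rewrite lt_neqAle minR// andbT; apply/eqP => eq1.
    by move: lt0; rewrite ltNge lexR' ?eq1.
  split.
  - split; first by rewrite finite_setU.
    by move=> _ [->|->].
  - by rewrite image_setU !image_set1.
  - by move=> _ [->|->]; [exact: lex_argmin01_good|exact: lex_argmin10_good].
  - by move=> _ -> /=; split=> //; [left|right].
  - move=> x Xx; case: (leP (g x 0 0) (g xR 0 0)) => [xR0|/ltW xR0].
      by right; exists (g xL, g xR) => //=; rewrite minL.
    left; exists (g xR); first by apply: conv_hull_sub; right.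
    by apply/le_vec2P; rewrite xR0 minR.
Qed.

End DichotomicSearchCorrect.

(** * Images of mixed-integer polytopes under worst-case objectives *)

Section WorstCase.
Variables (R : realType) (n m : nat) (f : 'I_2 -> 'rV[R]_n -> 'rV[R]_m -> R).
Implicit Types (U : set 'rV[R]_m) (x : 'rV[R]_n).

Lemma worst_case_argmax U x i xi :
  argmax U (f i x) xi -> worst_case f U x 0 i = f i x xi.
Proof.
case=> Uxi ximax; rewrite mxE; apply/eqP; rewrite eq_le; apply/andP; split.
  by apply: ge_sup => [|_ [xi' Uxi' <-]]; [exists (f i x xi), xi|exact: ximax].
by apply: ub_le_sup; [exists (f i x xi) => _ [xi' /ximax ? <-]|exists xi].
Qed.

Lemma worst_case_subset U U' x : U' `<=` U ->
  (forall i, argmax U (f i x) !=set0) -> (forall i, argmax U' (f i x) !=set0) ->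
  le_vec (worst_case f U' x) (worst_case f U x).
Proof.
move=> UU' aU aU' i; have [xi [Uxi ximax]] := aU i; have [xi' xi'max] := aU' i.
rewrite (worst_case_argmax xi'max) (worst_case_argmax (conj Uxi ximax)).
by apply: ximax; apply: UU'; case: xi'max.
Qed.

End WorstCase.

Lemma scalar_ray_le0 (R : realType) (E : lmodType R) (h : E -> R) (p d : E)
    (c : R) :
  scalar h -> (forall t, 0 <= t -> h (p + t *: d) <= c) -> h d <= 0.
Proof.
move=> lh hc; rewrite leNgt; apply/negP => hd.
have t0 : 0 <= (`|c - h p| + 1) / h d.
  by apply: divr_ge0; [exact: addr_ge0|exact: ltW].
have := hc _ t0.
rewrite -{1}[p]scale1r scalar_comb// mul1r divfK ?gt_eqF//.
have := ler_norm (c - h p); lra.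
Qed.

Definition simplex (R : realType) N : set 'rV[R]_N :=
  [set mu | (forall j, 0 <= mu 0 j) /\ \sum_j mu 0 j = 1].

Lemma conv_hull_tuple (R : realType) n N (v : N.-tuple 'rV[R]_n) :
  conv_hull [set` v] =
  [set mu *m (\matrix_j tnth v j) | mu in @simplex R N].
Proof.
set M := \matrix_j _; apply/seteqP; split; last first.
  move=> _ [mu [mu0 mu1] <-]; exists N, (tnth v), (fun j => mu 0 j); split=> //.
    by move=> j; exact: mem_tnth.
  by rewrite mulmx_sum_row; apply: eq_bigr => j _; rewrite rowK.
apply: conv_hull_min.
  move=> _ _ t [mu [mu0 mu1] <-] [nu [nu0 nu1] <-] /andP[t0 t1].
  exists (t *: mu + (1 - t) *: nu); last by rewrite mulmxDl -!scalemxAl.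
  split=> [j|]; first by rewrite !mxE addr_ge0// mulr_ge0// subr_ge0.
  under eq_bigr do rewrite !mxE.
  by rewrite big_split/= -!mulr_sumr mu1 nu1; ring.
move=> _ /tnthP[j ->]; exists (delta_mx 0 j); last by rewrite -rowE rowK.
split=> [j'|]; first by rewrite mxE ler0n.
rewrite (bigD1 j)//= big1 ?addr0 => [|j' /negPf j'j]; rewrite mxE eqxx.
  by rewrite eqxx.
by rewrite j'j.
Qed.

Section EpigraphPolytope.
Variables (R : realType) (n N r k : nat) (v : N.-tuple 'rV[R]_n).
Variables (phi : 'I_2 -> 'I_r.+1 -> 'rV[R]_n -> R) (B : R) (t : 'I_n -> R).
Hypothesis lphi : forall i s, scalar (phi i s).

Let M := \matrix_j tnth v j.

(* A point of the polytope lists the weights of a convex combination x of v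
   whose first k coordinates are prescribed by t, followed by an upper bound,
   itself at most B, on the two maxima of the functions phi at x. *)
Definition epigraph : set 'rV[R]_(N + 2) :=
  [set p | [/\ simplex (lsubmx p),
    forall i : {i : 'I_n | (i < k)%N}, (lsubmx p *m M) 0 (val i) = t (val i),
    forall i s, phi i s (lsubmx p *m M) <= rsubmx p 0 i
  & forall i, rsubmx p 0 i <= B]].

Let scalar_mu j : scalar (fun p : 'rV[R]_(N + 2) => - lsubmx p 0 j).
Proof. by move=> s p q; rewrite !mxE; ring. Qed.

Let scalar_sum : scalar (fun p : 'rV[R]_(N + 2) => \sum_j lsubmx p 0 j).
Proof.
move=> s p q; rewrite mulr_sumr -big_split/=.
by apply: eq_bigr => j _; rewrite !mxE.
Qed.

Let combination_comb s (p q : 'rV[R]_(N + 2)) :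
  lsubmx (s *: p + q) *m M = s *: (lsubmx p *m M) + lsubmx q *m M.
Proof. by rewrite linearP mulmxDl scalemxAl. Qed.

Let scalar_coord_x i : scalar (fun p : 'rV[R]_(N + 2) => (lsubmx p *m M) 0 i).
Proof. by move=> s p q; rewrite combination_comb; exact: scalar_coord. Qed.

Let scalar_epi i s : scalar (fun p : 'rV[R]_(N + 2) =>
  phi i s (lsubmx p *m M) - rsubmx p 0 i).
Proof. by move=> a p q; rewrite combination_comb lphi !mxE; ring. Qed.

Let scalar_y i : scalar (fun p : 'rV[R]_(N + 2) => rsubmx p 0 i).
Proof. by move=> a p q; rewrite !mxE. Qed.

(** A direction of a half-line has nonnegative weights with sum at most 0, so its weight part
    vanishes. Its bound part is at most 0 because of the truncation at [B], and at least 0 because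
    of the function with index [ord0]. *)
Lemma polytope_epigraph : polytope epigraph.
Proof.
apply: Minkowski => [|p d Qp].
  rewrite (_ : epigraph =
    [set p | forall j, - lsubmx p 0 j <= 0] `&`
    [set p | \sum_j lsubmx p 0 j = 1] `&`
    [set p | forall i : {i : 'I_n | (i < k)%N},
      (lsubmx p *m M) 0 (val i) = t (val i)] `&`
    [set p | forall i s, phi i s (lsubmx p *m M) - rsubmx p 0 i <= 0] `&`
    [set p | forall i, rsubmx p 0 i <= B]).
    repeat apply: polyhedronI.
    - by apply: polyhedron_bigcap => j; exact/polyhedron_halfspace/scalar_mu.
    - exact/polyhedron_hyperplane/scalar_sum.
    - apply: polyhedron_bigcap => i.
      exact/polyhedron_hyperplane/scalar_coord_x.
    - apply: polyhedron_bigcap => i; apply: polyhedron_bigcap => s.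
      exact/polyhedron_halfspace/scalar_epi.
    - by apply: polyhedron_bigcap => i; exact/polyhedron_halfspace/scalar_y.
  apply/seteqP; split=> q /=.
    case=> -[mu0 mu1] xt le_y yB; do !split=> //.
      by move=> j; rewrite oppr_le0.
    by move=> i s; rewrite subr_le0.
  case=> -[[[mu0 mu1] xt] le_y] yB; split=> //; first split=> // j.
    by rewrite -oppr_le0.
  by move=> i s; rewrite -subr_le0.
move=> /eqP dN0; apply: contrapT => ray; apply: dN0.
have {}ray s : 0 <= s -> epigraph (p + s *: d).
  by move=> s0; apply: contrapT => nQ; apply: ray; exists s.
have d_ge0 j : 0 <= lsubmx d 0 j.
  rewrite -oppr_le0; apply: (scalar_ray_le0 (p := p) (c := 0) (scalar_mu j)).
  by move=> s /ray[[+ _] _ _ _] => /(_ j); rewrite oppr_le0.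
have sumd0 : \sum_j lsubmx d 0 j <= 0.
  by apply: (scalar_ray_le0 (p := p) (c := 1) scalar_sum) => s /ray[[_ ->]].
have mud0 : lsubmx d = 0.
  apply/rowP => j; rewrite [RHS]mxE.
  have /psumr_eq0P : \sum_j lsubmx d 0 j = 0.
    by apply/eqP; rewrite eq_le sumd0 sumr_ge0.
  by apply.
have yd0 : rsubmx d = 0.
  apply/rowP => i; rewrite [RHS]mxE; apply/eqP; rewrite eq_le.
  apply/andP; split.
    by apply: (scalar_ray_le0 (p := p) (c := B) (scalar_y i)) => s /ray[].
  have := scalar_ray_le0 (p := p) (d := d) (c := 0) (scalar_epi i ord0).
  have -> : phi i ord0 (lsubmx d *m M) = 0.
    by rewrite mud0 mul0mx; exact: scalar_at0.
  rewrite sub0r oppr_le0; apply => s /ray[_ _ le_y _].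
  by rewrite subr_le0.
by rewrite -[d]hsubmxK mud0 yd0 row_mx0.
Qed.

End EpigraphPolytope.

(** Generators taken from epigraphs may lie strictly above the image; each is replaced by a point of
    [A] below it. *)
Lemma dominating_in_set (R : realType) p (A Z : set 'rV[R]_p) :
  finite_set Z -> Z `<=` upper_set A -> A `<=` upper_set (conv_hull Z) ->
  exists S0, [/\ finite_set S0, S0 `<=` A & A `<=` upper_set (conv_hull S0)].
Proof.
move=> fZ ZA AZ.
have /choice[c cP] z : exists y, Z z -> A y /\ le_vec y z.
  by have [/ZA[y]|nZz] := pselect (Z z); [exists y|exists z].
exists (c @` Z); split; first exact: finite_image.
  by move=> _ [z Zz <-]; case: (cP _ Zz).
apply: subset_trans AZ _; apply: conv_hull_sub_upper_set => z Zz.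
exists (c z); last by case: (cP _ Zz).
by apply: conv_hull_sub; exists z.
Qed.

Theorem bro_dominating (R : realType) (n m k : nat) (X : set 'rV[R]_n)
    (U : set 'rV[R]_m) (f : 'I_2 -> 'rV[R]_n -> 'rV[R]_m -> R) :
  bro1 k X -> finite_set U -> U !=set0 ->
  (forall i xi, U xi -> exists psi : {linear 'rV[R]_n -> R^o},
     forall x, X x -> f i x xi = psi x) ->
  exists S0, [/\ finite_set S0, S0 `<=` worst_case f U @` X
    & worst_case f U @` X `<=` upper_set (conv_hull S0)].
Proof.
move=> [P [V /finite_seqP[vs ->] ->] XE] fU U0 lin.
have argmaxU i x : argmax U (f i x) !=set0 by exact: finite_argmax.
have [r [u UE]] : exists r (u : r.+1.-tuple 'rV[R]_m), U = [set` u].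
  have /finite_seqP[[|a s] E] := fU; first by case: U0 => xi; rewrite E.
  by exists (size s), [tuple of a :: in_tuple s].
have Uu s : U (tnth u s) by rewrite UE /= mem_tnth.
have uU xi : U xi -> exists s, xi = tnth u s by rewrite UE /= => /tnthP.
have /choice[h hP] (q : 'I_2 * 'I_r.+1) : exists h : 'rV[R]_n -> R,
    scalar h /\ forall x, X x -> f q.1 x (tnth u q.2) = h x.
  have [psi psiE] := lin q.1 _ (Uu q.2); exists psi; split=> // a x y.
  exact: linearP.
pose phi i s := h (i, s).
have phiP i s : scalar (phi i s) /\
  forall x, X x -> f i x (tnth u s) = phi i s x by exact: (hP (i, s)).
pose v := in_tuple vs.
have PB (a : 'rV[R]_n -> R) (c : R) : scalar a ->
    (forall j, a (tnth v j) <= c) -> forall x, conv_hull [set` v] x -> a x <= c.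
  move=> la ac x Px; rewrite -lerN2.
  apply: (conv_hull_scalar_ge (h := fun y => - a y) _ _ Px).
    by move=> s y z; rewrite la; ring.
  by move=> _ /tnthP[j ->]; rewrite lerN2.
(* [B] bounds every [phi] at the generators, hence on their hull, so the truncation cuts off no
   image point. *)
pose B := \big[Num.max/0]_(q : 'I_2 * 'I_r.+1 * 'I_(size vs))
  phi q.1.1 q.1.2 (tnth v q.2).
have leB i s j : phi i s (tnth v j) <= B by exact: (le_bigmax _ _ (i, s, j)).
pose C := \big[Num.max/0]_(q : 'I_n * 'I_(size vs)) `|tnth v q.2 0 q.1|.
pose b := Num.bound C.
have leC x i : conv_hull [set` v] x -> `|x 0 i| <= b%:R.
  have Cb : C <= b%:R by apply/ltW/archi_boundP; exact: bigmax_ge_id.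
  have vC j : `|tnth v j 0 i| <= b%:R.
    apply: le_trans Cb.
    exact: (le_bigmax _ (fun q => `|tnth v q.2 0 q.1|) (i, j)).
  move=> Px; rewrite ler_norml; apply/andP; split; last first.
    apply: (PB _ _ (scalar_coord i)) => // j.
    exact: le_trans (ler_norm _) (vC j).
  rewrite lerNl; apply: (PB _ _ (scalar_opp_coord i)) => // j.
  by rewrite (le_trans _ (vC j))// -normrN ler_norm.
(* Integer coordinates lie between [-b] and [b]; [t] stores them shifted by [b], so finitely many
   [t] cover all integer parts. *)
pose coords (t : {ffun 'I_n -> 'I_(b + b).+1}) i : R := (t i)%:R - b%:R.
pose Q t := epigraph k v phi B (coords t).
have /choice[W WP] t : exists W, finite_set W /\ Q t = conv_hull W.
  have [//|W fW QW] := @polytope_epigraph R n _ _ k v phi B (coords t).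
    by move=> i s; case: (phiP i s).
  by exists W.
pose Z := \bigcup_t (rsubmx @` W t).
apply: (@dominating_in_set _ _ _ Z).
- apply: bigcup_finite => [|t _]; first exact: finite_finset.
  by apply: finite_image; case: (WP t).
- move=> _ [t _ [p Wp <-]].
  have : Q t p by case: (WP t) => _ ->; exact: conv_hull_sub.
  case=> smu xt le_y _; set x := lsubmx p *m _ in xt le_y.
  have Xx : X x.
    rewrite XE; split.
      by rewrite -[vs]/(tval v) conv_hull_tuple; exists (lsubmx p).
    move=> i ik; rewrite (xt (exist _ i ik)) /coords.
    by rewrite rpredB ?rpred_nat.
  exists (worst_case f U x); first by exists x.
  move=> i; have [xi ximax] := argmaxU i x; rewrite (worst_case_argmax ximax).
  have [s xis] := uU _ ximax.1.
  by rewrite xis; have [_ ->//] := phiP i s.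
- move=> _ [x Xx <-]; apply: sub_upper_set.
  have [Px xint] : conv_hull [set` v] x /\
      forall i : 'I_n, (i < k)%N -> x 0 i \is a Num.int.
    by move: (Xx); rewrite XE => -[].
  have := Px; rewrite conv_hull_tuple => -[mu smu mux].
  (* Among the first [k] coordinates the shifted value is a natural number at most [b + b], so
     truncation and [inord] are exact; the epigraph prescribes only these coordinates. *)
  pose t : {ffun 'I_n -> 'I_(b + b).+1} :=
    [ffun i => inord (Num.truncn (x 0 i + b%:R))].
  pose p := row_mx mu (worst_case f U x).
  have Qp : Q t p.
    rewrite /Q /epigraph /= row_mxKl row_mxKr mux; split=> //.
    + move=> [i ik] /=; have := leC _ i Px; rewrite ler_norml => /andP[xb bx].
      have xb_nat : x 0 i + b%:R \is a Num.nat.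
        rewrite -[_ \is a Num.nat]intrEge0 ?rpredD ?rpred_nat ?xint//.
        by rewrite -lerBlDr sub0r.
      rewrite /coords ffunE inordK ?truncnK ?addrK//.
      rewrite ltnS -(ler_nat R) truncnK// natrD lerD2r//.
    + move=> i s; have [_ <-//] := phiP i s.
      have [xi ximax] := argmaxU i x; rewrite (worst_case_argmax ximax).
      exact: ximax.2.
    + move=> i; have [xi ximax] := argmaxU i x.
      rewrite (worst_case_argmax ximax).
      have [s xis] := uU _ ximax.1; have [lh hx] := phiP i s.
      by rewrite xis hx//; apply: (PB _ _ lh).
  rewrite -[worst_case f U x](@row_mxKr _ _ _ _ mu) -/p.
  have {Qp} : conv_hull (W t) p by case: (WP t) => _ <-.
  apply: (@conv_hull_min _ _ _ [set q | conv_hull Z (rsubmx q)]).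
    move=> q1 q2 s /= h1 h2 s01; rewrite linearD !linearZ/=.
    exact: conv_hull_closed.
  by move=> q Wq; apply: conv_hull_sub; exists t => //; exists q.
Qed.

(** * The robust optimizer's approach *)

Section RobustOptimizersApproach.
Variables (R : realType) (n m : nat).
Variables (X : set 'rV[R]_n) (U : set 'rV[R]_m).
Variables (f : 'I_2 -> 'rV[R]_n -> 'rV[R]_m -> R) (D : set 'rV[R]_m).

(** A search state that can still step is not [DsDone], so until the search ends [RoaSearch] is the
    only rule that applies. *)
Lemma inevitably_search (P : ds_state R 'rV[R]_n -> Prop) Q j Uj s :
  inevitably (ds_step X (worst_case f Uj)) P s ->
  (forall s', P s' -> inevitably (roa_step X U f D) Q (RoaPass j Uj s')) ->
  inevitably (roa_step X U f D) Q (RoaPass j Uj s).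
Proof.
move=> inev PQ; elim: inev => [s0 /PQ//|s0 [s1 s01] _ IH].
apply: inevitably_next => [|t st].
  by exists (RoaPass j Uj s1); exact: RoaSearch.
move E: (RoaPass j Uj s0) st => r st; case: st E => //.
- by move=> j0 U0 s2 s3 s23 [? ? ?]; subst j0 U0 s2; exact: IH.
- move=> j0 U0 U0' Ys Xs _ _ [_ _ s0E]; rewrite s0E in s01.
  by inversion s01.
- move=> j0 U0 U0' Ys Xs _ _ [_ _ s0E]; rewrite s0E in s01.
  by inversion s01.
Qed.

Hypothesis X0 : X !=set0.
Hypothesis fD : finite_set D.
Hypothesis argmaxD : forall x i, X x -> exists xi, argmax U (f i x) xi /\ D xi.
Hypothesis dominatingU : forall U', finite_set U' -> U' !=set0 -> U' `<=` U ->
  exists S0, [/\ finite_set S0, S0 `<=` worst_case f U' @` X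
    & worst_case f U' @` X `<=` upper_set (conv_hull S0)].

Let argmaxU x i : X x -> argmax U (f i x) !=set0.
Proof. by move=> /(argmaxD i)[xi []]; exists xi. Qed.

Let pessimization_exists Xs Uj :
  Xs `<=` X -> exists Uj', pessimization U f D Xs Uj Uj'.
Proof.
move=> XsX.
have /choice[w wP] (q : 'rV[R]_n * 'I_2) : exists xi, X q.1 ->
    argmax U (f q.2 q.1) xi /\ D xi.
  have [/(argmaxD q.2)[xi xiP]|nX] := pselect (X q.1); first by exists xi.
  by exists 0.
eexists; exists (fun x i => w (x, i)); last by [].
by move=> x i /XsX; exact: (wP (x, i)).
Qed.

Lemma roa_terminates N j Uj :
  finite_set Uj -> Uj !=set0 -> Uj `<=` U ->
  (j + #|` fset_set (D `\` Uj)| < N)%N ->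
  inevitably (roa_step X U f D) (returned_within X U f N)
    (RoaPass j Uj (DsStart R 'rV[R]_n)).
Proof.
have [d] := ubnP #|` fset_set (D `\` Uj)|.
elim: d j Uj => // d IHd j Uj ltd fUj Uj0 UjU ltN.
have [S0 [fS0 S0X XS0]] := dominatingU fUj Uj0 UjU.
have [fS Snd XS] := ext_supp_generate fS0 S0X XS0.
apply: inevitably_search (dichotomic_search_correct X0 fS XS) _.
case=> // Ys Xs [fXs repXs]; have XsX := repXs.1.
apply: inevitably_next => [|s st].
  have [Uj' pUj] := pessimization_exists Uj XsX.
  have [stop|cont] := pselect (forall x, Xs x ->
      worst_case f U x = worst_case f Uj x).
    by eexists; exact: RoaStop pUj stop.
  by eexists; exact: RoaContinue pUj cont.
have argmaxUj x i : argmax Uj (f i x) !=set0 by exact: finite_argmax.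
move E: (RoaPass j Uj _) st => r st; case: st E => //.
- move=> j0 U0 s2 s3 s23 [_ _ ?]; subst s2; by inversion s23.
- move=> j0 U0 Uj' Ys0 Xs0 [w wP ->] + [? ? _ ?]; subst j0 U0 Xs0 => cont.
  set U1 := _ `|` _.
  have [x [i [Xsx neq]]] : exists x i,
      Xs x /\ worst_case f U x 0 i <> worst_case f Uj x 0 i.
    apply: contrapT => nex; apply: cont => x Xsx; apply/rowP => i.
    by apply: contrapT => neq; apply: nex; exists x, i.
  have [wmax Dw] := wP x i Xsx.
  (* If the maximizer were already in [Uj], the relaxation would be exact at [x] in component
     [i]. *)
  have nUw : ~ Uj (w x i).
    move=> Ujw; apply: neq.
    rewrite (worst_case_argmax wmax).
    rewrite (@worst_case_argmax _ _ _ _ Uj _ _ (w x i))//.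
    by split=> // xi /UjU; exact: wmax.2.
  have lt_missing : (#|` fset_set (D `\` U1)| < #|` fset_set (D `\` Uj)|)%N.
    apply: (@ltn_card_fset_set _ _ _ (w x i)) => //.
    - exact: finite_setD.
    - by move=> xi [Dxi nU1]; split=> // Ujxi; apply: nU1; left.
    - by case=> _; apply; right; exists x, i.
  apply: IHd.
  - exact: leq_trans lt_missing _.
  - rewrite finite_setU; split=> //.
    apply: (@sub_finite_set _ _ ((fun q => w q.1 q.2) @` (Xs `*` [set: 'I_2]))).
      by move=> _ [x' [i' [Xsx' ->]]]; exists (x', i').
    by apply/finite_image/finite_setX => //; exact: finite_finset.
  - by case: Uj0 => xi Ujxi; exists xi; left.
  - by move=> xi [/UjU//|[x' [i' [Xsx' ->]]]]; case: (wP x' i' Xsx') => -[].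
  - by apply: leq_ltn_trans ltN; rewrite addSn -addnS leq_add2l.
- move=> j0 U0 Uj' Ys0 Xs0 _ + [? ? ? ?]; subst j0 U0 Xs0 Ys0 => stop.
  apply: inevitably_now; split.
    by apply: leq_ltn_trans ltN; exact: leq_addr.
  apply: representative_ese_relax stop Snd XS repXs => x Xx.
  by apply: worst_case_subset => // i; exact: argmaxU.
Qed.

End RobustOptimizersApproach.

(** There is at most one pass per pessimization scenario missing from [U0], plus the stopping pass.
    In (i) [U0] always contains such a scenario, which saves one pass; in (ii) it does if it meets
    [E], and otherwise the bound is one larger. *)
Theorem lemma17 (R : realType) (n m k : nat)
    (X : set 'rV[R]_n) (U : set 'rV[R]_m)
    (f : 'I_2 -> 'rV[R]_n -> 'rV[R]_m -> R) :
  (k <= n)%N -> X !=set0 -> U !=set0 ->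
  bro1 k X -> bro2 U -> bro3 X U f ->
  (finite_set U ->
     forall U0 : set 'rV[R]_m, finite_set U0 -> U0 !=set0 -> U0 `<=` U ->
       roa_correct_within X U f U U0 #|` fset_set U|) /\
  (forall U0 : set 'rV[R]_m, finite_set U0 -> U0 !=set0 -> U0 `<=` U ->
     let E := extreme_points (conv_hull U) in
     let K := #|` fset_set E| in
     (U0 `&` E !=set0 -> roa_correct_within X U f E U0 K) /\
     roa_correct_within X U f E U0 K.+1).
Proof.
move=> _ X0 Une bX bU [lin qc].
have dom U' : finite_set U' -> U' !=set0 -> U' `<=` U ->
    exists S0, [/\ finite_set S0, S0 `<=` worst_case f U' @` X
      & worst_case f U' @` X `<=` upper_set (conv_hull S0)].
  by move=> fU' U'0 U'U; apply: (bro_dominating bX) => // i xi /U'U; exact: lin.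
have missing_lt (D U0 : set 'rV[R]_m) : finite_set D -> U0 `&` D !=set0 ->
    (#|` fset_set (D `\` U0)| < #|` fset_set D|)%N.
  move=> fD [xi [U0xi Dxi]]; apply: (ltn_card_fset_set fD (x := xi)) => //.
  by case=> _; exact.
split=> [fU U0 fU0 [xi U0xi] U0U|U0 fU0 U0ne U0U E K].
  apply: roa_terminates => //.
  - move=> x i _; have [xi' ximax] := finite_argmax (f i x) fU Une.
    by exists xi'; split=> //; case: ximax.
  - by exists xi.
  - by apply: missing_lt => //; exists xi; split=> //; exact: U0U.
(* A finite [V] inside [U] with the same hull treats both cases of [bro2] at once: generators of the
   polytope, or [U] itself. *)
have [V [fV V0 VU VUE]] : exists V, [/\ finite_set V, V !=set0, V `<=` U
    & conv_hull U = conv_hull V].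
  case: bU => [[V fV UE]|fU]; last by exists U; split.
  exists V; split=> //; last by rewrite UE conv_hullK.
    by apply: conv_hull_nonempty; rewrite -UE.
  by rewrite UE; exact: conv_hull_sub.
have [EV fE _] := extreme_points_generate fV; rewrite -VUE -/E in EV fE.
have argmaxE x i : X x -> exists xi, argmax U (f i x) xi /\ E xi.
  (* An extreme point that maximizes over the hull lies in [V], hence in [U], and so maximizes over
     [U]. *)
  move=> Xx; have [] := @argmax_extreme_points _ _ V (f i x) fV V0.
    by rewrite -VUE; case: (qc i x Xx).
  rewrite -VUE => xi [Exi [_ ximax]]; exists xi; split=> //.
  by split=> [|xi' Uxi']; [exact/VU/EV|exact/ximax/conv_hull_sub].
split=> [U0E|]; apply: roa_terminates => //; first exact: missing_lt.
have fEU : finite_set (E `\` U0) by exact: finite_setD.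
by rewrite add0n ltnS; apply: fsubset_leq_card; rewrite -fset_set_sub.
Qed.
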